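(* A domain $\Omega\subset\mathbb D$ is a contractive domain if and only if there exists $R=R(\Omega)>0$ such that $\Omega$ contains no hyperbolic disc of hyperbolic radius $R$.
   Context: A domain $\Omega\subset\mathbb D$ is called contractive if every analytic map $f:\mathbb D\to\Omega$ satisfies $\sup_{z\in\mathbb D}\frac{(1-|z|^2)|f'(z)|}{1-|f(z)|^2}<1$. The hyperbolic distance is $d_h(z,w)=\frac12\log\frac{1+\rho^2}{1-\rho^2}$, $\rho=\big|\frac{z-w}{1-\overline wz}\big|$; a hyperbolic disc of radius $R$ is $\{w: d_h(w,a)<R\}$ for some $a\in\mathbb D$. *)

(* Defs.v *)
From Stdlib Require Import Reals.
From Coquelicot Require Import Coquelicot.
Open Scope R_scope.

Definition in_disc (z : C) : Prop := Cmod z < 1.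

Definition connected_set (S : C -> Prop) : Prop :=
  forall U V : C -> Prop, open U -> open V ->
    (forall z, S z -> U z \/ V z) ->
    (exists z, S z /\ U z) -> (exists z, S z /\ V z) ->
    exists z, S z /\ U z /\ V z.

Definition subdomain_of_disc (Om : C -> Prop) : Prop :=
  (exists z, Om z) /\ open Om /\ connected_set Om /\ (forall z, Om z -> in_disc z).

Definition has_cderiv (f : C -> C) (z l : C) : Prop :=
  @is_derive C_AbsRing C_NormedModule f z l.

Definition analytic_on_disc (f : C -> C) : Prop :=
  forall z, in_disc z -> exists l, has_cderiv f z l.

Definition contractive (Om : C -> Prop) : Prop :=
  forall f : C -> C, analytic_on_disc f -> (forall z, in_disc z -> Om (f z)) ->
    exists c, c < 1 /\
      forall z l, in_disc z -> has_cderiv f z l ->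
        (1 - Cmod z ^ 2) * Cmod l / (1 - Cmod (f z) ^ 2) <= c.

Definition pseudo_hyp (z w : C) : R :=
  Cmod (Cdiv (Cminus z w) (Cminus (RtoC 1) (Cmult (Cconj w) z))).

Definition d_h (z w : C) : R :=
  / 2 * ln ((1 + pseudo_hyp z w ^ 2) / (1 - pseudo_hyp z w ^ 2)).

Definition hyp_disc (a : C) (R : R) (w : C) : Prop :=
  in_disc w /\ d_h w a < R.

(* Main.v *)
Require Import Defs.
From Stdlib Require Import Reals Lra Lia Classical IndefiniteDescription Relations Compare_dec.
From Coquelicot Require Import Coquelicot.
Open Scope R_scope.

(** If a map [h] of the disc into itself fixes [0], has [|h'(0)|] close to [1] and omits [w],
    then [w] is close to the unit circle: Schwarz-Pick for [h(z)/z] makes [|h|] close to [1] on a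
    suitable circle, and the maximum principle for [1 / mob w h], where [mob w] is the Moebius map
    sending [w] to [0], compares [|w|] with the minimum of [|mob w h|] on that circle.  After
    normalisation by Moebius maps this gives one implication.  Since maps are only assumed to be
    complex differentiable, the maximum principle is derived from Goursat's theorem on rectangles
    in the coordinate [log z].

    Conversely, if [Om] contains arbitrarily large hyperbolic discs, join them by a sequence
    [p_0, p_1, ...] such that the closed disc with diameter [[p_n, p_(n+1)]] lies in [Om] for every
    [n], the large discs being among these.  With [u = (1 + z) / (1 - z)], which has positive real
    part, and [t_n] growing fast enough, the map [p_0 + sum_n (p_(n+1) - p_n) u / (u + t_n)] is, for
    [|u|] comparable to [t_n], uniformly close to the conformal map
    [p_n + (p_(n+1) - p_n) u / (u + t_n)] of the half-plane onto the [n]-th disc.  Hence it takes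
    its values in [Om] and has hyperbolic derivative close to [1] at the preimages of the centres
    of the large discs. *)

(** * Complex differentiation *)

(** Contractivity bounds the hyperbolic derivative of each map separately, by a constant that may
    depend on the map. Arbitrarily large discs therefore contradict it only through a single map
    with hyperbolic derivatives arbitrarily close to 1, and one series has to visit all the large
    discs. Discs with diameter [p_n, p_(n+1)] suit this because u / (u + t) maps the right
    half-plane onto the disc with diameter [0, 1] and is close to 0 for |u| much smaller than t and
    close to 1 for |u| much larger: each map ends where the next one begins, and a margin around
    each closed disc absorbs the errors.

    In the other direction the difficulty is that h(z)/z, completed at 0 by the derivative, is
    visibly continuous there, while its differentiability at 0 is not immediate; the quotient behind
    Schwarz-Pick has the same defect at its base point. The maximum principle is therefore proved
    for continuous functions that are differentiable off two points. *)

Definition cderiv (f : C -> C) (z l : C) : Prop :=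
  forall eps : R, 0 < eps -> exists del : R, 0 < del /\
    forall w : C, Cmod (w - z) < del ->
      Cmod (f w - f z - l * (w - z)) <= eps * Cmod (w - z).

Definition ccont (f : C -> C) (z : C) : Prop :=
  forall eps : R, 0 < eps -> exists del : R, 0 < del /\
    forall w : C, Cmod (w - z) < del -> Cmod (f w - f z) < eps.

Definition cdiff (f : C -> C) (z : C) : Prop := exists l, cderiv f z l.

Lemma locally_C_Cmod (z : C) (P : C -> Prop) :
  @locally (AbsRing_UniformSpace C_AbsRing) z P <->
  exists del : R, 0 < del /\ forall w : C, Cmod (w - z) < del -> P w.
Proof.
  split.
  - intros [d H]. exists d. split; [apply cond_pos|]. intros w Hw. apply H. exact Hw.
  - intros [d [Hd H]]. exists (mkposreal d Hd). intros w Hw. apply H. exact Hw.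
Qed.

Lemma is_derive_cderiv (f : C -> C) (z l : C) :
  @is_derive C_AbsRing (AbsRing_NormedModule C_AbsRing) f z l <-> cderiv f z l.
Proof.
  split.
  - intros [_ H] eps He.
    apply (locally_C_Cmod z (fun w => Cmod (f w - f z - l * (w - z)) <= eps * Cmod (w - z))).
    generalize (H z (fun P HP => HP) (mkposreal eps He)).
    apply filter_imp. intros w Hw. rewrite (Cmult_comm l). exact Hw.
  - intros H. split.
    + apply is_linear_scal_l.
    + intros x Hx eps.
      assert (Hzx : z = x)
        by exact (@is_filter_lim_locally_unique C_AbsRing (AbsRing_NormedModule C_AbsRing) z x Hx).
      subst x.
      apply (proj2 (locally_C_Cmod z _)).
      destruct (H eps (cond_pos eps)) as [d [Hd Hw]].
      exists d. split; [exact Hd|]. intros w Hwz.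
      specialize (Hw w Hwz). rewrite (Cmult_comm l) in Hw. exact Hw.
Qed.

(** The two library derivatives differ in the uniform structure of the target, product or modulus.
    Their error clauses mention only norms and are convertible, so only linearity is proved
    again. *)
Lemma has_cderiv_cderiv (f : C -> C) (z l : C) : has_cderiv f z l <-> cderiv f z l.
Proof.
  rewrite <- is_derive_cderiv. split.
  - intros [_ H]. split; [apply is_linear_scal_l|]. exact H.
  - intros [_ H]. split; [apply (@is_linear_scal_l C_AbsRing C_NormedModule)|]. exact H.
Qed.

Lemma continuous_ccont (f : C -> C) (z : C) :
  @continuous (AbsRing_UniformSpace C_AbsRing) (AbsRing_UniformSpace C_AbsRing) f z
  <-> ccont f z.
Proof.
  split.
  - intros H eps He.
    apply (locally_C_Cmod z (fun w => Cmod (f w - f z) < eps)).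
    apply (H (fun y => Cmod (y - f z) < eps)).
    apply locally_C_Cmod. exists eps. split; [exact He|]. auto.
  - intros H P HP. apply locally_C_Cmod in HP. destruct HP as [e [He HP]].
    destruct (H e He) as [d [Hd Hw]].
    apply (proj2 (locally_C_Cmod z (fun x => P (f x)))).
    exists d. split; [exact Hd|]. intros w Hwz. apply HP, Hw, Hwz.
Qed.

Lemma cderiv_const (c z : C) : cderiv (fun _ => c) z 0.
Proof. apply is_derive_cderiv. apply (@is_derive_const C_AbsRing (AbsRing_NormedModule C_AbsRing)). Qed.

Lemma cderiv_id (z : C) : cderiv (fun w => w) z 1.
Proof. apply is_derive_cderiv. apply (@is_derive_id C_AbsRing). Qed.

Lemma cderiv_plus (f g : C -> C) (z l m : C) :
  cderiv f z l -> cderiv g z m -> cderiv (fun w => f w + g w)%C z (l + m)%C.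
Proof.
  rewrite <- !is_derive_cderiv.
  apply (@is_derive_plus C_AbsRing (AbsRing_NormedModule C_AbsRing)).
Qed.

Lemma cderiv_minus (f g : C -> C) (z l m : C) :
  cderiv f z l -> cderiv g z m -> cderiv (fun w => f w - g w)%C z (l - m)%C.
Proof.
  rewrite <- !is_derive_cderiv.
  apply (@is_derive_minus C_AbsRing (AbsRing_NormedModule C_AbsRing)).
Qed.

Lemma cderiv_mult (f g : C -> C) (z l m : C) :
  cderiv f z l -> cderiv g z m -> cderiv (fun w => f w * g w)%C z (l * g z + f z * m)%C.
Proof.
  rewrite <- !is_derive_cderiv. intros Hf Hg.
  apply (@is_derive_mult C_AbsRing f g z l m Hf Hg Cmult_comm).
Qed.

Lemma cderiv_comp (f g : C -> C) (z l m : C) :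
  cderiv f (g z) l -> cderiv g z m -> cderiv (fun w => f (g w)) z (m * l)%C.
Proof.
  rewrite <- !is_derive_cderiv.
  apply (@is_derive_comp C_AbsRing (AbsRing_NormedModule C_AbsRing)).
Qed.

Lemma cderiv_ext (f g : C -> C) (z l : C) (d : R) :
  0 < d -> (forall w, Cmod (w - z) < d -> f w = g w) -> cderiv f z l -> cderiv g z l.
Proof.
  intros Hd E H eps He. destruct (H eps He) as [d' [Hd' Hw]].
  exists (Rmin d d'). split; [apply Rmin_pos; auto|]. intros w Hwz.
  rewrite <- !E. apply Hw.
  - eapply Rlt_le_trans; [exact Hwz|apply Rmin_r].
  - replace (z - z)%C with (RtoC 0) by ring. rewrite Cmod_0. exact Hd.
  - eapply Rlt_le_trans; [exact Hwz|apply Rmin_l].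
Qed.

(** Inversion and the series of ramps both come with an explicit second-order remainder. *)
Lemma cderiv_quadratic (f : C -> C) (z l : C) (d M : R) :
  0 < d -> (forall w, Cmod (w - z) < d ->
    Cmod (f w - f z - l * (w - z)) <= M * Cmod (w - z) ^ 2) -> cderiv f z l.
Proof.
  intros Hd H eps He.
  assert (HM : 0 < Rabs M + 1) by (generalize (Rabs_pos M); lra).
  exists (Rmin d (eps / (Rabs M + 1))). split.
  { apply Rmin_pos; auto. apply Rdiv_lt_0_compat; auto. }
  intros w Hw.
  assert (Hw1 := Rlt_le_trans _ _ _ Hw (Rmin_l _ _)).
  assert (Hw2 := Rlt_le_trans _ _ _ Hw (Rmin_r _ _)).
  apply (Rle_trans _ _ _ (H w Hw1)).
  generalize (Cmod_ge_0 (w - z)). intros H0.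
  replace (M * Cmod (w - z) ^ 2) with ((M * Cmod (w - z)) * Cmod (w - z)) by ring.
  apply Rmult_le_compat_r; auto.
  apply Rle_trans with ((Rabs M + 1) * Cmod (w - z)).
  - apply Rmult_le_compat_r; auto. generalize (Rle_abs M); lra.
  - apply Rlt_le. apply (Rmult_lt_compat_l _ _ _ HM) in Hw2.
    replace ((Rabs M + 1) * (eps / (Rabs M + 1))) with eps in Hw2 by (field; lra). exact Hw2.
Qed.

Lemma cderiv_Cinv (z : C) : z <> 0 -> cderiv Cinv z (- / (z * z))%C.
Proof.
  intros Hz. assert (Pz := proj1 (Cmod_gt_0 z) Hz).
  apply cderiv_quadratic with (d := Cmod z / 2) (M := 2 / Cmod z ^ 3); [lra|].
  intros w Hw.
  assert (Hw2 : Cmod z / 2 <= Cmod w).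
  { generalize (Cmod_triangle w (z - w)). replace (w + (z - w))%C with z by ring.
    replace (Cmod (z - w)) with (Cmod (w - z)).
    2:{ rewrite <- Cmod_opp. f_equal. ring. }
    lra. }
  assert (Hw0 : w <> 0) by (apply Cmod_gt_0; lra).
  replace (/ w - / z - - / (z * z) * (w - z))%C with ((w - z) * (w - z) / (w * (z * z)))%C
    by (field; split; auto).
  rewrite Cmod_div by (repeat apply Cmult_neq_0; auto). rewrite !Cmod_mult.
  replace (2 / Cmod z ^ 3 * Cmod (w - z) ^ 2)
    with (Cmod (w - z) * Cmod (w - z) / (Cmod z / 2 * (Cmod z * Cmod z))) by (field; lra).
  apply Rmult_le_compat_l.
  - apply Rmult_le_pos; apply Cmod_ge_0.
  - apply Rinv_le_contravar.
    + repeat apply Rmult_lt_0_compat; lra.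
    + apply Rmult_le_compat_r; auto. apply Rmult_le_pos; lra.
Qed.

Lemma cderiv_div (f g : C -> C) (z l m : C) :
  cderiv f z l -> cderiv g z m -> g z <> 0 ->
  cderiv (fun w => f w / g w)%C z ((l * g z - f z * m) / (g z * g z))%C.
Proof.
  intros Hf Hg H0.
  replace ((l * g z - f z * m) / (g z * g z))%C
    with (l * / g z + f z * (m * (- / (g z * g z))))%C by (field; auto).
  apply (cderiv_mult f (fun w => / g w)%C); auto.
  apply (cderiv_comp Cinv g); auto. apply cderiv_Cinv; auto.
Qed.

Lemma cderiv_ccont (f : C -> C) (z l : C) : cderiv f z l -> ccont f z.
Proof.
  intros H. apply continuous_ccont.
  apply (@filterdiff_continuous C_AbsRing (AbsRing_NormedModule C_AbsRing) (AbsRing_NormedModule C_AbsRing)).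
  apply is_derive_cderiv in H. eexists. exact H.
Qed.

Lemma ccont_minus (f g : C -> C) (z : C) :
  ccont f z -> ccont g z -> ccont (fun w => f w - g w)%C z.
Proof.
  rewrite <- !continuous_ccont.
  apply (@continuous_minus (AbsRing_UniformSpace C_AbsRing) C_AbsRing (AbsRing_NormedModule C_AbsRing)).
Qed.

Lemma ccont_mult (f g : C -> C) (z : C) :
  ccont f z -> ccont g z -> ccont (fun w => f w * g w)%C z.
Proof.
  rewrite <- !continuous_ccont.
  apply (@continuous_mult (AbsRing_UniformSpace C_AbsRing) C_AbsRing).
Qed.

Lemma ccont_comp (f g : C -> C) (z : C) :
  ccont g z -> ccont f (g z) -> ccont (fun w => f (g w)) z.
Proof.
  rewrite <- !continuous_ccont.
  apply (@continuous_comp (AbsRing_UniformSpace C_AbsRing)).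
Qed.

Lemma ccont_div (f g : C -> C) (z : C) :
  ccont f z -> ccont g z -> g z <> 0 -> ccont (fun w => f w / g w)%C z.
Proof.
  intros Hf Hg H0. apply (ccont_mult f (fun w => / g w)%C); auto.
  apply (ccont_comp Cinv g); auto.
  eapply cderiv_ccont, cderiv_Cinv, H0.
Qed.

Lemma ccont_const (c z : C) : ccont (fun _ => c) z.
Proof. eapply cderiv_ccont, cderiv_const. Qed.

Lemma ccont_id (z : C) : ccont (fun w => w) z.
Proof. eapply cderiv_ccont, cderiv_id. Qed.

Lemma cdiff_ccont (f : C -> C) (z : C) : cdiff f z -> ccont f z.
Proof. intros [l H]. eapply cderiv_ccont, H. Qed.

Lemma cdiff_const (c z : C) : cdiff (fun _ => c) z.
Proof. eexists. apply cderiv_const. Qed.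

Lemma cdiff_id (z : C) : cdiff (fun w => w) z.
Proof. eexists. apply cderiv_id. Qed.

Lemma cdiff_minus (f g : C -> C) (z : C) :
  cdiff f z -> cdiff g z -> cdiff (fun w => f w - g w)%C z.
Proof. intros [l Hf] [m Hg]. eexists. apply cderiv_minus; eassumption. Qed.

Lemma cdiff_mult (f g : C -> C) (z : C) :
  cdiff f z -> cdiff g z -> cdiff (fun w => f w * g w)%C z.
Proof. intros [l Hf] [m Hg]. eexists. apply cderiv_mult; eassumption. Qed.

Lemma cdiff_div (f g : C -> C) (z : C) :
  cdiff f z -> cdiff g z -> g z <> 0 -> cdiff (fun w => f w / g w)%C z.
Proof. intros [l Hf] [m Hg] H0. eexists. apply cderiv_div; eassumption. Qed.

Lemma cdiff_comp (f g : C -> C) (z : C) :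
  cdiff g z -> cdiff f (g z) -> cdiff (fun w => f (g w)) z.
Proof. intros [l Hf] [m Hg]. eexists. apply cderiv_comp; eassumption. Qed.

Lemma cdiff_pow (f : C -> C) (z : C) (n : nat) :
  cdiff f z -> cdiff (fun w => Cpow (f w) n) z.
Proof.
  intros H. induction n as [|n IH]; simpl.
  - apply cdiff_const.
  - apply (cdiff_mult f); auto.
Qed.

Lemma ccont_pow (f : C -> C) (z : C) (n : nat) :
  ccont f z -> ccont (fun w => Cpow (f w) n) z.
Proof.
  intros H. induction n as [|n IH]; simpl.
  - apply ccont_const.
  - apply (ccont_mult f); auto.
Qed.

Lemma Cmod_minus_sym (z w : C) : Cmod (z - w) = Cmod (w - z).
Proof. rewrite <- Cmod_opp. f_equal. ring. Qed.

Lemma Cmod_minus_triangle (x y z : C) : Cmod (x - z) <= Cmod (x - y) + Cmod (y - z).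
Proof. replace (x - z)%C with ((x - y) + (y - z))%C by ring. apply Cmod_triangle. Qed.

Lemma Cmod_triangle_rev (x y : C) : Cmod x - Cmod y <= Cmod (x - y).
Proof.
  generalize (Cmod_triangle (x - y) y). replace (x - y + y)%C with x by ring. lra.
Qed.

(** * Goursat's theorem on rectangles *)

(** Both coefficients of [P dx + Q dy] are totally differentiable at the point; the shared [B]
    encodes closedness, [dP/dy = dQ/dx]. Partial derivatives need not be continuous. *)
Definition closed_form_at (P Q : R -> R -> R) (x y : R) : Prop :=
  exists A B D : R, forall eps : R, 0 < eps -> exists del : R, 0 < del /\
    forall x' y' : R, Rabs (x' - x) < del -> Rabs (y' - y) < del ->
      Rabs (P x' y' - P x y - A * (x' - x) - B * (y' - y))
        <= eps * (Rabs (x' - x) + Rabs (y' - y)) /\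
      Rabs (Q x' y' - Q x y - B * (x' - x) - D * (y' - y))
        <= eps * (Rabs (x' - x) + Rabs (y' - y)).

Lemma RInt_Rplus (f g : R -> R) (a b : R) :
  ex_RInt f a b -> ex_RInt g a b ->
  RInt (fun x => f x + g x) a b = RInt f a b + RInt g a b.
Proof. apply (@RInt_plus R_CompleteNormedModule). Qed.

Lemma RInt_Rminus (f g : R -> R) (a b : R) :
  ex_RInt f a b -> ex_RInt g a b ->
  RInt (fun x => f x - g x) a b = RInt f a b - RInt g a b.
Proof. apply (@RInt_minus R_CompleteNormedModule). Qed.

Lemma RInt_Rconst (a b c : R) : RInt (fun _ => c) a b = (b - a) * c.
Proof. apply (@RInt_const R_CompleteNormedModule). Qed.

Lemma continuous_of_linear_approx (f : R -> R) (x A : R) :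
  (exists del : R, 0 < del /\ forall x', Rabs (x' - x) < del ->
     Rabs (f x' - f x - A * (x' - x)) <= 1 * Rabs (x' - x)) ->
  continuous f x.
Proof.
  intros [d [Hd H]].
  apply continuity_pt_filterlim. intros eps He.
  set (K := Rabs A + 1). assert (HK : 0 < K) by (unfold K; generalize (Rabs_pos A); lra).
  exists (Rmin d (eps / K)). split.
  { apply Rmin_pos; auto. apply Rdiv_lt_0_compat; auto. }
  intros x' [_ Hx']. simpl in *. unfold R_dist in *.
  assert (H1 := Rlt_le_trans _ _ _ Hx' (Rmin_l _ _)).
  assert (H2 := Rlt_le_trans _ _ _ Hx' (Rmin_r _ _)).
  specialize (H x' H1).
  apply Rle_lt_trans with (K * Rabs (x' - x)).
  - replace (f x' - f x) with ((f x' - f x - A * (x' - x)) + A * (x' - x)) by ring.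
    eapply Rle_trans; [apply Rabs_triang|]. rewrite Rabs_mult. unfold K. lra.
  - apply (Rmult_lt_compat_l _ _ _ HK) in H2.
    replace (K * (eps / K)) with eps in H2 by (field; lra). exact H2.
Qed.

Lemma closed_form_continuous_x (P Q : R -> R -> R) (x y : R) :
  closed_form_at P Q x y -> continuous (fun t => P t y) x.
Proof.
  intros (A & B & D & H). destruct (H 1 Rlt_0_1) as [d [Hd Hw]].
  apply continuous_of_linear_approx with A. exists d. split; auto. intros x' Hx'.
  destruct (Hw x' y Hx') as [H1 _].
  { rewrite Rminus_diag, Rabs_R0. exact Hd. }
  rewrite !Rminus_diag, Rabs_R0, Rmult_0_r, Rminus_0_r, Rplus_0_r in H1. exact H1.
Qed.

Lemma closed_form_continuous_y (P Q : R -> R -> R) (x y : R) :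
  closed_form_at P Q x y -> continuous (fun t => Q x t) y.
Proof.
  intros (A & B & D & H). destruct (H 1 Rlt_0_1) as [d [Hd Hw]].
  apply continuous_of_linear_approx with D. exists d. split; auto. intros y' Hy'.
  destruct (Hw x y') as [_ H1]; auto.
  { rewrite Rminus_diag, Rabs_R0. exact Hd. }
  rewrite !Rminus_diag, Rabs_R0, Rmult_0_r, Rminus_0_r, Rplus_0_l in H1. exact H1.
Qed.

(* The integral of [P dx + Q dy] along the boundary of [[a, b] x [c, d]], with opposite sides
   paired. *)
Definition rect_integral (P Q : R -> R -> R) (a b c d : R) : R :=
  RInt (fun x => P x c - P x d) a b + RInt (fun y => Q b y - Q a y) c d.

Definition closed_form_on (P Q : R -> R -> R) (a b c d : R) : Prop :=
  forall x y, a <= x <= b -> c <= y <= d -> closed_form_at P Q x y.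

Lemma closed_form_on_sub (P Q : R -> R -> R) (a b c d a' b' c' d' : R) :
  closed_form_on P Q a b c d -> a <= a' -> b' <= b -> c <= c' -> d' <= d ->
  closed_form_on P Q a' b' c' d'.
Proof. intros H ? ? ? ? x y Hx Hy. apply H; lra. Qed.

Lemma closed_form_ex_RInt_x (P Q : R -> R -> R) (a b c d y y' : R) :
  closed_form_on P Q a b c d -> a <= b -> c <= y <= d -> c <= y' <= d ->
  ex_RInt (fun x => P x y - P x y') a b.
Proof.
  intros H Hab Hy Hy'. apply (@ex_RInt_continuous R_CompleteNormedModule). intros x Hx.
  rewrite Rmin_left, Rmax_right in Hx by auto.
  apply (@continuous_minus R_UniformSpace R_AbsRing R_NormedModule);
    eapply closed_form_continuous_x; apply H; auto.
Qed.

Lemma closed_form_ex_RInt_y (P Q : R -> R -> R) (a b c d x x' : R) :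
  closed_form_on P Q a b c d -> c <= d -> a <= x <= b -> a <= x' <= b ->
  ex_RInt (fun y => Q x y - Q x' y) c d.
Proof.
  intros H Hab Hy Hy'. apply (@ex_RInt_continuous R_CompleteNormedModule). intros y Hx.
  rewrite Rmin_left, Rmax_right in Hx by auto.
  apply (@continuous_minus R_UniformSpace R_AbsRing R_NormedModule);
    eapply closed_form_continuous_y; apply H; auto.
Qed.

Lemma rect_integral_split_x (P Q : R -> R -> R) (a b c d m : R) :
  closed_form_on P Q a b c d -> a <= m <= b -> c <= d ->
  rect_integral P Q a b c d = rect_integral P Q a m c d + rect_integral P Q m b c d.
Proof.
  intros H Hm Hcd. unfold rect_integral.
  rewrite <- (RInt_Chasles (fun x => P x c - P x d) a m b).
  - rewrite (RInt_ext (fun y => Q b y - Q a y) (fun y => (Q m y - Q a y) + (Q b y - Q m y))).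
    2:{ intros t _. simpl. ring. }
    rewrite RInt_Rplus.
    + unfold plus; simpl. ring.
    + apply (closed_form_ex_RInt_y P Q a b); auto; lra.
    + apply (closed_form_ex_RInt_y P Q a b); auto; lra.
  - apply (closed_form_ex_RInt_x P Q a m c d); try lra.
    eapply closed_form_on_sub; try exact H; lra.
  - apply (closed_form_ex_RInt_x P Q m b c d); try lra.
    eapply closed_form_on_sub; try exact H; lra.
Qed.

Lemma rect_integral_split_y (P Q : R -> R -> R) (a b c d m : R) :
  closed_form_on P Q a b c d -> a <= b -> c <= m <= d ->
  rect_integral P Q a b c d = rect_integral P Q a b c m + rect_integral P Q a b m d.
Proof.
  intros H Hab Hm. unfold rect_integral.
  rewrite <- (RInt_Chasles (fun y => Q b y - Q a y) c m d).
  - rewrite (RInt_ext (fun x => P x c - P x d) (fun x => (P x c - P x m) + (P x m - P x d))).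
    2:{ intros t _. simpl. ring. }
    rewrite RInt_Rplus.
    + unfold plus; simpl. ring.
    + apply (closed_form_ex_RInt_x P Q a b c d); auto; lra.
    + apply (closed_form_ex_RInt_x P Q a b c d); auto; lra.
  - apply (closed_form_ex_RInt_y P Q a b c m); try lra.
    eapply closed_form_on_sub; try exact H; lra.
  - apply (closed_form_ex_RInt_y P Q a b m d); try lra.
    eapply closed_form_on_sub; try exact H; lra.
Qed.

Lemma rect_integral_quarter (P Q : R -> R -> R) (a c w h K : R) :
  closed_form_on P Q a (a + w) c (c + h) -> 0 <= w -> 0 <= h ->
  K < Rabs (rect_integral P Q a (a + w) c (c + h)) ->
  exists a' c', a <= a' <= a + w / 2 /\ c <= c' <= c + h / 2 /\
    K / 4 < Rabs (rect_integral P Q a' (a' + w / 2) c' (c' + h / 2)).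
Proof.
  intros H Hw Hh HK.
  set (a1 := a + w / 2). set (c1 := c + h / 2).
  assert (Ea : a1 + w / 2 = a + w) by (unfold a1; field).
  assert (Ec : c1 + h / 2 = c + h) by (unfold c1; field).
  assert (La : a <= a1 <= a + w) by (unfold a1; lra).
  assert (Lc : c <= c1 <= c + h) by (unfold c1; lra).
  assert (Hl : closed_form_on P Q a a1 c (c + h)) by (eapply closed_form_on_sub; try exact H; lra).
  assert (Hr : closed_form_on P Q a1 (a + w) c (c + h)) by (eapply closed_form_on_sub; try exact H; lra).
  rewrite (rect_integral_split_x P Q _ _ _ _ a1) in HK; try lra; auto.
  rewrite (rect_integral_split_y P Q a a1 _ _ c1) in HK; try lra; auto.
  rewrite (rect_integral_split_y P Q a1 (a + w) _ _ c1) in HK; try lra; auto.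
  set (I1 := rect_integral P Q a a1 c c1) in *.
  set (I2 := rect_integral P Q a a1 c1 (c + h)) in *.
  set (I3 := rect_integral P Q a1 (a + w) c c1) in *.
  set (I4 := rect_integral P Q a1 (a + w) c1 (c + h)) in *.
  assert (HT : K < Rabs I1 + Rabs I2 + (Rabs I3 + Rabs I4)).
  { eapply Rlt_le_trans; [exact HK|].
    eapply Rle_trans; [apply Rabs_triang|].
    apply Rplus_le_compat; apply Rabs_triang. }
  destruct (Rlt_le_dec (K / 4) (Rabs I1)) as [D1|D1].
  { exists a, c. fold a1 c1. repeat split; try lra. exact D1. }
  destruct (Rlt_le_dec (K / 4) (Rabs I2)) as [D2|D2].
  { exists a, c1. fold a1. rewrite Ec. repeat split; try lra. exact D2. }
  destruct (Rlt_le_dec (K / 4) (Rabs I3)) as [D3|D3].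
  { exists a1, c. fold c1. rewrite Ea. repeat split; try lra. exact D3. }
  exists a1, c1. rewrite Ea, Ec. repeat split; try (fold I4; lra).
Qed.

(** The affine parts of [P] and [Q] integrate to zero: pairing opposite sides removes everything but
    the mixed terms, which contribute [- w * (B * h)] and [h * (B * w)]. Only the [eps] errors on
    the four sides remain. *)
Lemma rect_integral_small (P Q : R -> R -> R) (a c w h x y B eps : R) :
  closed_form_on P Q a (a + w) c (c + h) -> 0 <= w -> 0 <= h -> 0 <= eps ->
  a <= x <= a + w -> c <= y <= c + h ->
  (exists A D, forall x' y', a <= x' <= a + w -> c <= y' <= c + h ->
      Rabs (P x' y' - P x y - A * (x' - x) - B * (y' - y))
        <= eps * (Rabs (x' - x) + Rabs (y' - y)) /\
      Rabs (Q x' y' - Q x y - B * (x' - x) - D * (y' - y))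
        <= eps * (Rabs (x' - x) + Rabs (y' - y))) ->
  Rabs (rect_integral P Q a (a + w) c (c + h)) <= 2 * eps * (w + h) ^ 2.
Proof.
  intros H Hw Hh He Hx Hy (A & D & HPQ).
  assert (HB : forall x' y', a <= x' <= a + w -> c <= y' <= c + h ->
             eps * (Rabs (x' - x) + Rabs (y' - y)) <= eps * (w + h)).
  { intros x' y' Hx' Hy'. apply Rmult_le_compat_l; auto.
    apply Rplus_le_compat; apply Rabs_le; lra. }
  assert (EP : RInt (fun x' => P x' c - P x' (c + h)) a (a + w) + 0
             = RInt (fun x' => P x' c - P x' (c + h) + B * h) a (a + w) - w * (B * h)).
  { rewrite RInt_Rplus.
    - rewrite RInt_Rconst. ring.
    - apply (closed_form_ex_RInt_x P Q a (a + w) c (c + h)); auto; lra.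
    - apply ex_RInt_const. }
  assert (EQ : RInt (fun y' => Q (a + w) y' - Q a y') c (c + h) + 0
             = RInt (fun y' => Q (a + w) y' - Q a y' - B * w) c (c + h) + h * (B * w)).
  { rewrite (RInt_Rminus (fun y' => Q (a + w) y' - Q a y') (fun _ => B * w)).
    - rewrite RInt_Rconst. ring.
    - apply (closed_form_ex_RInt_y P Q a (a + w) c (c + h)); auto; lra.
    - apply ex_RInt_const. }
  rewrite !Rplus_0_r in *.
  unfold rect_integral. rewrite EP, EQ.
  set (I1 := RInt _ a (a + w)). set (I2 := RInt _ c (c + h)).
  replace (I1 - w * (B * h) + (I2 + h * (B * w))) with (I1 + I2) by ring.
  assert (H1 : Rabs I1 <= w * (2 * (eps * (w + h)))).
  { replace w with ((a + w) - a) at 1 by ring.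
    apply abs_RInt_le_const; [lra| |].
    - apply (@ex_RInt_plus R_NormedModule (fun x' => P x' c - P x' (c + h)) (fun _ => B * h)).
      + apply (closed_form_ex_RInt_x P Q a (a + w) c (c + h)); auto; lra.
      + apply ex_RInt_const.
    - intros x' Hx'.
      destruct (HPQ x' c Hx') as [K1 _]; [lra|].
      destruct (HPQ x' (c + h) Hx') as [K2 _]; [lra|].
      assert (L1 := HB x' c Hx' ltac:(lra)). assert (L2 := HB x' (c + h) Hx' ltac:(lra)).
      replace (P x' c - P x' (c + h) + B * h) with
        ((P x' c - P x y - A * (x' - x) - B * (c - y))
          - (P x' (c + h) - P x y - A * (x' - x) - B * (c + h - y))) by ring.
      unfold Rminus at 1. eapply Rle_trans; [apply Rabs_triang|]. rewrite Rabs_Ropp. lra. }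
  assert (H2 : Rabs I2 <= h * (2 * (eps * (w + h)))).
  { replace h with ((c + h) - c) at 1 by ring.
    apply abs_RInt_le_const; [lra| |].
    - apply (@ex_RInt_minus R_NormedModule (fun y' => Q (a + w) y' - Q a y') (fun _ => B * w)).
      + apply (closed_form_ex_RInt_y P Q a (a + w) c (c + h)); auto; lra.
      + apply ex_RInt_const.
    - intros y' Hy'.
      destruct (HPQ a y') as [_ K1]; [lra|lra|].
      destruct (HPQ (a + w) y') as [_ K2]; [lra|lra|].
      assert (L1 := HB a y' ltac:(lra) Hy'). assert (L2 := HB (a + w) y' ltac:(lra) Hy').
      replace (Q (a + w) y' - Q a y' - B * w) with
        ((Q (a + w) y' - Q x y - B * (a + w - x) - D * (y' - y))
          - (Q a y' - Q x y - B * (a - x) - D * (y' - y))) by ring.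
      unfold Rminus at 1. eapply Rle_trans; [apply Rabs_triang|]. rewrite Rabs_Ropp. lra. }
  eapply Rle_trans; [apply Rabs_triang|].
  replace (2 * eps * (w + h) ^ 2) with (w * (2 * (eps * (w + h))) + h * (2 * (eps * (w + h)))) by ring.
  lra.
Qed.

(** Every left endpoint lies below every right endpoint, so the supremum of the left endpoints is a
    common point. *)
Lemma nested_intervals (u l : nat -> R) :
  (forall n, u n <= u (S n)) -> (forall n, u (S n) + l (S n) <= u n + l n) ->
  (forall n, 0 <= l n) -> exists x, forall n, u n <= x <= u n + l n.
Proof.
  intros Hu Hl Hp.
  assert (Hu' : forall n k, u n <= u (k + n)%nat).
  { intros n k. induction k as [|k IH]; simpl; [lra|]. generalize (Hu (k + n)%nat). lra. }
  assert (Hl' : forall n k, u (k + n)%nat + l (k + n)%nat <= u n + l n).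
  { intros n k. induction k as [|k IH]; simpl; [lra|]. generalize (Hl (k + n)%nat). lra. }
  assert (Hm : forall n m, u n <= u m + l m).
  { intros n m. destruct (Nat.le_ge_cases n m) as [L|L].
    - generalize (Hu' n (m - n)%nat) (Hp m). replace (m - n + n)%nat with m by lia. lra.
    - generalize (Hl' m (n - m)%nat) (Hp n). replace (n - m + m)%nat with n by lia. lra. }
  destruct (completeness (fun y => exists n, y = u n)) as [x [Hx1 Hx2]].
  - exists (u O + l O). intros y [n ->]. apply Hm.
  - exists (u O), O. reflexivity.
  - exists x. intros n. split.
    + apply Hx1. exists n. reflexivity.
    + apply Hx2. intros y [m ->]. apply Hm.
Qed.

(** Repeated quartering keeps the integral above [K / 4 ^ n], while differentiability at the common
    point of the rectangles bounds it by a small multiple of [(L / 2 ^ n) ^ 2]. *)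
Theorem goursat_rectangle (P Q : R -> R -> R) (a b c d : R) :
  closed_form_on P Q a b c d -> a <= b -> c <= d -> rect_integral P Q a b c d = 0.
Proof.
  intros H Hab Hcd.
  destruct (Req_dec (rect_integral P Q a b c d) 0) as [E|NE]; auto. exfalso.
  set (w := fun n => (b - a) / 2 ^ n). set (h := fun n => (d - c) / 2 ^ n).
  assert (P2 : forall n, 0 < 2 ^ n) by (intros; apply pow_lt; lra).
  assert (Hw : forall n, 0 <= w n).
  { intros n. apply Rmult_le_pos; [lra|]. apply Rlt_le, Rinv_0_lt_compat, P2. }
  assert (Hh : forall n, 0 <= h n).
  { intros n. apply Rmult_le_pos; [lra|]. apply Rlt_le, Rinv_0_lt_compat, P2. }
  assert (HwS : forall n, w (S n) = w n / 2).
  { intros n. unfold w. simpl. field. apply Rgt_not_eq, P2. }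
  assert (HhS : forall n, h (S n) = h n / 2).
  { intros n. unfold h. simpl. field. apply Rgt_not_eq, P2. }
  (* Half of the integral, so that the strict bound in [good] already holds at stage 0. *)
  set (K := Rabs (rect_integral P Q a b c d) / 2).
  assert (HK : 0 < K).
  { unfold K. apply Rabs_pos_lt in NE. lra. }
  set (good := fun n (p : R * R) =>
     a <= fst p /\ fst p + w n <= b /\ c <= snd p /\ snd p + h n <= d /\
     K / 4 ^ n < Rabs (rect_integral P Q (fst p) (fst p + w n) (snd p) (snd p + h n))).
  assert (Hstep : forall n p, good n p -> exists p', good (S n) p' /\
     fst p <= fst p' <= fst p + w n / 2 /\ snd p <= snd p' <= snd p + h n / 2).
  { intros n [x y] (G1 & G2 & G3 & G4 & G5). simpl in *.
    destruct (rect_integral_quarter P Q x y (w n) (h n) (K / 4 ^ n)) as (x' & y' & A1 & A2 & A3); auto.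
    { eapply closed_form_on_sub; try exact H; lra. }
    exists (x', y'). unfold good. simpl. rewrite HwS, HhS.
    repeat split; try lra.
    replace (K / (4 * 4 ^ n)) with (K / 4 ^ n / 4); [lra|].
    field. apply pow_nonzero. lra. }
  assert (H0 : good O (a, c)).
  { unfold good, w, h. simpl. replace (a + (b - a) / 1) with b by field.
    replace (c + (d - c) / 1) with d by field. repeat split; try lra.
    unfold K in *. lra. }
  assert (Hseq : exists s : nat -> R * R, forall n, good n (s n) /\
     fst (s n) <= fst (s (S n)) <= fst (s n) + w n / 2 /\
     snd (s n) <= snd (s (S n)) <= snd (s n) + h n / 2).
  (* The premise [good] inside the relation makes it total, so that plain choice yields the
     dependent sequence. *)
  { destruct (functional_choice (fun (np : nat * (R * R)) p' => good (fst np) (snd np) ->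
       good (S (fst np)) p' /\
       fst (snd np) <= fst p' <= fst (snd np) + w (fst np) / 2 /\
       snd (snd np) <= snd p' <= snd (snd np) + h (fst np) / 2)) as [f Hf].
    { intros [n p]. destruct (classic (good n p)) as [G|G].
      - destruct (Hstep n p G) as [p' Hp']. exists p'. intros _. exact Hp'.
      - exists p. intros G'. contradiction. }
    set (s := nat_rect (fun _ => (R * R)%type) (a, c) (fun n p => f (n, p))).
    assert (Hs : forall n, good n (s n)).
    { induction n as [|n IH]; [exact H0|]. apply (Hf (n, s n) IH). }
    exists s. intros n. split; [apply Hs|]. apply (Hf (n, s n) (Hs n)). }
  destruct Hseq as [s Hs].
  destruct (nested_intervals (fun n => fst (s n)) w) as [x Hx]; auto.
  { intros n. apply Hs. }
  { intros n. rewrite HwS. destruct (Hs n) as (_ & L & _). lra. }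
  destruct (nested_intervals (fun n => snd (s n)) h) as [y Hy]; auto.
  { intros n. apply Hs. }
  { intros n. rewrite HhS. destruct (Hs n) as (_ & _ & L). lra. }
  destruct (H x y) as (A & B & D & HD).
  { generalize (Hx O). destruct (Hs O) as ((G1 & G2 & G3 & G4 & G5) & _). lra. }
  { generalize (Hy O). destruct (Hs O) as ((G1 & G2 & G3 & G4 & G5) & _). lra. }
  set (L := b - a + (d - c)). assert (HL : 0 <= L) by (unfold L; lra).
  (* Gives [2 * eps * L ^ 2 <= K]; the [+ 1] covers degenerate rectangles. *)
  set (eps := K / (2 * (L ^ 2 + 1))).
  assert (HL2 : 0 <= L ^ 2) by apply pow2_ge_0.
  assert (Heps : 0 < eps) by (unfold eps; apply Rdiv_lt_0_compat; lra).
  destruct (HD eps Heps) as [del [Hdel Hloc]].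
  assert (Hn : exists n, L / 2 ^ n < del).
  { destruct (pow_lt_1_zero (/ 2)) with (y := del / (L + 1)) as [n Hn].
    - rewrite Rabs_right; lra.
    - apply Rdiv_lt_0_compat; lra.
    - exists n. specialize (Hn n (Nat.le_refl n)).
      assert (Pi : 0 < (/ 2) ^ n) by (apply pow_lt; lra).
      rewrite Rabs_right in Hn by lra. unfold Rdiv. rewrite <- pow_inv.
      apply Rle_lt_trans with ((L + 1) * (/ 2) ^ n); [nra|].
      apply (Rmult_lt_compat_l (L + 1)) in Hn; [|lra].
      replace ((L + 1) * (del / (L + 1))) with del in Hn by (field; lra). exact Hn. }
  destruct Hn as [n Hn].
  destruct (Hs n) as ((G1 & G2 & G3 & G4 & G5) & _).
  assert (Ewh : w n + h n = L / 2 ^ n).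
  { unfold w, h, L. field. apply Rgt_not_eq, P2. }
  generalize (Hw n) (Hh n) (Hx n) (Hy n). intros Pw Ph Xn Yn.
  assert (HB : Rabs (rect_integral P Q (fst (s n)) (fst (s n) + w n) (snd (s n)) (snd (s n) + h n))
             <= 2 * eps * (w n + h n) ^ 2).
  { apply rect_integral_small with (x := x) (y := y) (B := B); try lra.
    { eapply closed_form_on_sub; try exact H; lra. }
    exists A, D. intros x' y' Hx' Hy'. apply Hloc.
    - apply Rle_lt_trans with (w n); [apply Rabs_le; lra|lra].
    - apply Rle_lt_trans with (h n); [apply Rabs_le; lra|lra]. }
  rewrite Ewh in HB.
  assert (E4 : 2 * eps * (L / 2 ^ n) ^ 2 = K * (L ^ 2 / (L ^ 2 + 1)) / 4 ^ n).
  { unfold eps. replace 4 with (2 * 2) by ring. rewrite Rpow_mult_distr. field.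
    repeat split; try (apply pow_nonzero; lra); lra. }
  rewrite E4 in HB.
  assert (HF : K * (L ^ 2 / (L ^ 2 + 1)) / 4 ^ n <= K / 4 ^ n).
  { apply Rmult_le_compat_r; [apply Rlt_le, Rinv_0_lt_compat, pow_lt; lra|].
    rewrite <- (Rmult_1_r K) at 2. apply Rmult_le_compat_l; [lra|].
    apply Rle_div_l; lra. }
  lra.
Qed.

(** * The maximum principle on circles *)

Definition Cexp (z : C) : C := (exp (Re z) * cos (Im z), exp (Re z) * sin (Im z)).

Lemma Cexp_plus (z w : C) : Cexp (z + w) = (Cexp z * Cexp w)%C.
Proof.
  unfold Cexp, Cmult, Cplus, Re, Im. simpl.
  rewrite exp_plus, cos_plus, sin_plus. f_equal; ring.
Qed.

Lemma Cmod_Cexp (z : C) : Cmod (Cexp z) = exp (Re z).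
Proof.
  unfold Cexp, Cmod. simpl fst. simpl snd.
  replace ((exp (Re z) * cos (Im z)) ^ 2 + (exp (Re z) * sin (Im z)) ^ 2)
    with (exp (Re z) ^ 2).
  - apply sqrt_pow2, Rlt_le, exp_pos.
  - generalize (sin2_cos2 (Im z)). unfold Rsqr. intros H.
    transitivity (exp (Re z) ^ 2 * (sin (Im z) * sin (Im z) + cos (Im z) * cos (Im z))).
    + rewrite H. ring.
    + ring.
Qed.

Lemma Cmod_le_Rabs (z : C) : Cmod z <= Rabs (Re z) + Rabs (Im z).
Proof.
  replace z with ((RtoC (Re z)) + (RtoC (Im z)) * Ci)%C at 1.
  - eapply Rle_trans; [apply Cmod_triangle|].
    rewrite Cmod_mult, Cmod_Ci, !Cmod_R. lra.
  - destruct z as [x y]. unfold RtoC, Ci, Cmult, Cplus, Re, Im. simpl. f_equal; ring.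
Qed.

Lemma Im_le_Cmod (z : C) : Rabs (Im z) <= Cmod z.
Proof. eapply Rle_trans; [apply Rmax_r|apply (Rmax_Cmod z)]. Qed.

Lemma derivable_linear_approx (f : R -> R) (l : R) :
  derivable_pt_lim f 0 l -> forall eps, 0 < eps -> exists del, 0 < del /\
    forall h, Rabs h < del -> Rabs (f h - f 0 - l * h) <= eps * Rabs h.
Proof.
  intros H eps He. destruct (H eps He) as [[d Hd] Hh]. exists d. split; auto.
  intros h Hhd. simpl in Hh. destruct (Req_dec h 0) as [->|N].
  - rewrite Rabs_R0. replace (f 0 - f 0 - l * 0) with 0 by ring. rewrite Rabs_R0. lra.
  - specialize (Hh h N Hhd). rewrite Rplus_0_l in Hh.
    replace (f h - f 0 - l * h) with (((f h - f 0) / h - l) * h) by (field; auto).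
    rewrite Rabs_mult. apply Rmult_le_compat_r; [apply Rabs_pos|lra].
Qed.

Lemma cderiv_Cexp_0 : cderiv Cexp 0 1.
Proof.
  (* The four error terms below have weights 1 + 3 + 3 + 2 = 9. *)
  intros eps He. set (e := Rmin (eps / 9) 1).
  assert (He0 : 0 < e) by (unfold e; apply Rmin_pos; lra).
  assert (He1 : e <= 1) by apply Rmin_r.
  assert (He9 : 9 * e <= eps) by (generalize (Rmin_l (eps / 9) 1); fold e; lra).
  destruct (derivable_linear_approx exp 1) with (eps := e) as [d1 [Hd1 H1]]; auto.
  { rewrite <- exp_0. apply derivable_pt_lim_exp. }
  destruct (derivable_linear_approx cos 0) with (eps := e) as [d2 [Hd2 H2]]; auto.
  { replace 0 with (- sin 0) at 2 by (rewrite sin_0; ring). apply derivable_pt_lim_cos. }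
  destruct (derivable_linear_approx sin 1) with (eps := e) as [d3 [Hd3 H3]]; auto.
  { rewrite <- cos_0. apply derivable_pt_lim_sin. }
  set (d := Rmin (Rmin d1 e) (Rmin d2 d3)).
  assert (Hd : 0 < d) by (unfold d; apply Rmin_pos; apply Rmin_pos; auto).
  exists d. split; auto.
  intros w. replace (w - 0)%C with w by ring. intros Hw.
  destruct w as [x y].
  assert (Hx : Rabs x < d) by (eapply Rle_lt_trans; [apply (re_le_Cmod (x, y))|exact Hw]).
  assert (Hy : Rabs y < d) by (eapply Rle_lt_trans; [apply (Im_le_Cmod (x, y))|exact Hw]).
  assert (L1 : d <= d1) by (unfold d; eapply Rle_trans; [apply Rmin_l|apply Rmin_l]).
  assert (L2 : d <= e) by (unfold d; eapply Rle_trans; [apply Rmin_l|apply Rmin_r]).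
  assert (L3 : d <= d2) by (unfold d; eapply Rle_trans; [apply Rmin_r|apply Rmin_l]).
  assert (L4 : d <= d3) by (unfold d; eapply Rle_trans; [apply Rmin_r|apply Rmin_r]).
  specialize (H1 x ltac:(lra)). specialize (H2 y ltac:(lra)). specialize (H3 y ltac:(lra)).
  rewrite exp_0 in H1. rewrite cos_0 in H2. rewrite sin_0 in H3.
  set (al := exp x - 1 - 1 * x) in *. set (be := cos y - 1 - 0 * y) in *.
  set (ga := sin y - 0 - 1 * y) in *.
  assert (Ex : Rabs (exp x) <= 3).
  { replace (exp x) with (al + (1 + x)) by (unfold al; ring).
    eapply Rle_trans; [apply Rabs_triang|].
    generalize (Rabs_triang 1 x). rewrite Rabs_R1. generalize (Rabs_pos x). nra. }
  assert (Ex1 : Rabs (exp x - 1) <= 2 * e).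
  { replace (exp x - 1) with (al + x) by (unfold al; ring).
    eapply Rle_trans; [apply Rabs_triang|]. generalize (Rabs_pos x). nra. }
  replace (Cexp (x, y) - Cexp 0 - 1 * (x, y))%C
    with (al + exp x * be, exp x * ga + (exp x - 1) * y).
  2:{ unfold Cexp, Cminus, Cplus, Copp, Cmult, RtoC, Re, Im, al, be, ga. simpl.
      rewrite exp_0, cos_0, sin_0. f_equal; ring. }
  eapply Rle_trans; [apply Cmod_le_Rabs|]. unfold Re, Im. simpl fst. simpl snd.
  assert (Mx : Rabs x <= Cmod (x, y)) by apply (re_le_Cmod (x, y)).
  assert (My : Rabs y <= Cmod (x, y)) by apply (Im_le_Cmod (x, y)).
  assert (B1 : Rabs (al + exp x * be) <= e * Rabs x + 3 * (e * Rabs y)).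
  { eapply Rle_trans; [apply Rabs_triang|]. apply Rplus_le_compat; auto.
    rewrite Rabs_mult. apply Rmult_le_compat; auto; apply Rabs_pos. }
  assert (B2 : Rabs (exp x * ga + (exp x - 1) * y) <= 3 * (e * Rabs y) + 2 * e * Rabs y).
  { eapply Rle_trans; [apply Rabs_triang|]. apply Rplus_le_compat.
    - rewrite Rabs_mult. apply Rmult_le_compat; auto; apply Rabs_pos.
    - rewrite Rabs_mult. apply Rmult_le_compat_r; auto; apply Rabs_pos. }
  generalize (Cmod_ge_0 (x, y)) (Rabs_pos x) (Rabs_pos y). intros.
  apply Rle_trans with (9 * e * Cmod (x, y)); [|apply Rmult_le_compat_r; lra].
  nra.
Qed.

(** The addition formula transports differentiability from 0 to [z]. *)
Lemma cdiff_Cexp (z : C) : cdiff Cexp z.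
Proof.
  destruct (cdiff_mult (fun _ => Cexp z) (fun w => Cexp (w - z)%C) z) as [l Hl].
  - apply cdiff_const.
  - apply (cdiff_comp Cexp (fun w => w - z)%C).
    + apply cdiff_minus; [apply cdiff_id|apply cdiff_const].
    + replace (z - z)%C with (RtoC 0) by ring. eexists. apply cderiv_Cexp_0.
  - exists l. eapply cderiv_ext with (d := 1); [lra| |exact Hl].
    intros w _. cbv beta. rewrite <- Cexp_plus. f_equal. ring.
Qed.

(* The Cauchy-Riemann equations: [Im g dx + Re g dy] is the imaginary part of [g dz]. *)
Lemma cdiff_closed_form (g : C -> C) (x y : R) :
  cdiff g (x, y) -> closed_form_at (fun x y => Im (g (x, y))) (fun x y => Re (g (x, y))) x y.
Proof.
  (* With derivative [p + i q], [Im g] varies by [q dx + p dy] and [Re g] by [p dx - q dy]. *)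
  intros [[p q] H]. exists q, p, (- q). intros eps He.
  destruct (H eps He) as [d [Hd Hw]].
  exists (d / 2). split; [lra|]. intros x' y' Hx Hy.
  assert (E : ((x', y') - (x, y))%C = (x' - x, y' - y)) by reflexivity.
  assert (L := Cmod_le_Rabs (x' - x, y' - y)). unfold Re, Im in L. simpl fst in L. simpl snd in L.
  specialize (Hw (x', y')). rewrite E in Hw.
  specialize (Hw ltac:(lra)).
  assert (L2 : eps * Cmod (x' - x, y' - y) <= eps * (Rabs (x' - x) + Rabs (y' - y)))
    by (apply Rmult_le_compat_l; lra).
  split.
  - eapply Rle_trans; [|exact L2]. eapply Rle_trans; [|exact Hw].
    eapply Rle_trans; [|apply Im_le_Cmod]. right. f_equal.
    unfold Im, Cminus, Cplus, Copp, Cmult. simpl. ring.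
  - eapply Rle_trans; [|exact L2]. eapply Rle_trans; [|exact Hw].
    eapply Rle_trans; [|apply re_le_Cmod]. right. f_equal.
    unfold Re, Cminus, Cplus, Copp, Cmult. simpl. ring.
Qed.

(* In the coordinate [w = log z] Goursat's theorem, applied to a rectangle of height [2 pi],
   says that the mean over the circle of radius [exp (Re w)] does not depend on [Re w]. *)
Lemma max_modulus_circle (F : C -> C) (r B : R) :
  0 < r -> (forall z, Cmod z <= r -> z <> 0 -> cdiff F z) -> ccont F 0 ->
  (forall z, Cmod z = r -> Cmod (F z) <= B) -> Cmod (F 0) <= B.
Proof.
  intros Hr HF H0 HB.
  assert (PB : 0 <= B).
  { eapply Rle_trans; [apply Cmod_ge_0|]. apply (HB (RtoC r)).
    rewrite Cmod_R, Rabs_right; lra. }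
  destruct (Rle_lt_dec (Cmod (F 0)) B) as [|N]; auto. exfalso.
  set (M := Cmod (F 0)) in *. assert (HM : 0 < M) by lra.
  (* A unimodular factor that rotates [F 0] to the positive real [M], so that real parts suffice. *)
  set (e := (Cconj (F 0) / RtoC M)%C).
  assert (NM : RtoC M <> 0) by (intros E; apply RtoC_inj in E; lra).
  assert (He : Cmod e = 1).
  { unfold e. rewrite Cmod_div, Cmod_conj, Cmod_R, Rabs_right; auto; [|lra].
    fold M. field. lra. }
  assert (EF0 : (e * F 0)%C = RtoC M).
  { unfold e. replace (Cconj (F 0) / RtoC M * F 0)%C with (F 0 * Cconj (F 0) / RtoC M)%C
      by (field; auto).
    rewrite <- Cmod2_conj. fold M. rewrite RtoC_pow. field. auto. }
  set (g := fun w => (e * F (Cexp w))%C).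
  set (ep := (M - B) / 2). assert (Hep : 0 < ep) by (unfold ep; lra).
  destruct (H0 ep Hep) as [d [Hd Hd2]].
  (* The circle of radius [exp s] is so small that [F] differs from [F 0] there by less than
     [ep]. *)
  set (s := Rmin (ln r) (ln (d / 2))).
  assert (Hs : s <= ln r) by apply Rmin_l.
  assert (Hs2 : exp s < d).
  { apply Rle_lt_trans with (exp (ln (d / 2))).
    - assert (L : s <= ln (d / 2)) by apply Rmin_r. destruct L as [L|E].
      + left. apply exp_increasing, L.
      + right. now rewrite E.
    - rewrite exp_ln; lra. }
  assert (HC : closed_form_on (fun x y => Im (g (x, y))) (fun x y => Re (g (x, y))) s (ln r) 0 (2 * PI)).
  { intros x y Hx _. apply cdiff_closed_form. unfold g.
    apply cdiff_mult; [apply cdiff_const|].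
    apply (cdiff_comp F Cexp); [apply cdiff_Cexp|].
    apply HF.
    - rewrite Cmod_Cexp. unfold Re. simpl. rewrite <- (exp_ln r Hr).
      destruct (proj2 Hx) as [L|E]; [left; apply exp_increasing, L|right; now rewrite E].
    - apply Cmod_gt_0. rewrite Cmod_Cexp. apply exp_pos. }
  assert (HPI := PI_RGT_0).
  assert (HG := goursat_rectangle _ _ _ _ _ _ HC Hs ltac:(lra)).
  unfold rect_integral in HG.
  assert (EX : exists v, is_RInt (fun y => Re (g (ln r, y)) - Re (g (s, y))) 0 (2 * PI) v).
  { eexists. apply (@RInt_correct R_CompleteNormedModule).
    apply (closed_form_ex_RInt_y _ _ _ _ _ _ _ _ HC); lra. }
  destruct EX as [v Hv].
  rewrite (is_RInt_unique _ _ _ _ Hv) in HG.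
  (* The horizontal sides cancel by the period [2 pi i] of [Cexp]. *)
  rewrite (RInt_ext _ (fun _ => 0)), RInt_Rconst in HG.
  2:{ intros x _. unfold g. replace (Cexp (x, 2 * PI)) with (Cexp (x, 0)).
      - apply Rminus_diag.
      - unfold Cexp, Re, Im. simpl. now rewrite cos_2PI, sin_2PI, cos_0, sin_0. }
  (* On the outer side the real part is at most [B], on the inner one at least [M - ep = B + ep]. *)
  assert (Hle : v <= (2 * PI - 0) * (- ep)).
  { apply (is_RInt_le (fun y => Re (g (ln r, y)) - Re (g (s, y))) (fun _ => - ep) 0 (2 * PI)); auto.
    - lra.
    - apply (@is_RInt_const R_NormedModule).
    - intros y _.
      assert (L1 : Re (g (ln r, y)) <= B).
      { eapply Rle_trans; [apply Rle_abs|]. eapply Rle_trans; [apply re_le_Cmod|].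
        unfold g. rewrite Cmod_mult, He, Rmult_1_l. apply HB. rewrite Cmod_Cexp.
        unfold Re. simpl. apply exp_ln, Hr. }
      assert (L2 : M - Re (g (s, y)) <= ep).
      { apply Rle_trans with (Cmod (e * (F 0 - F (Cexp (s, y))))).
        - eapply Rle_trans; [|apply re_le_Cmod]. eapply Rle_trans; [|apply Rle_abs]. right.
          replace (e * (F 0 - F (Cexp (s, y))))%C with (e * F 0 - g (s, y))%C by (unfold g; ring).
          rewrite EF0. unfold Re, Cminus, Cplus, Copp, RtoC. simpl. ring.
        - rewrite Cmod_mult, He, Rmult_1_l, Cmod_minus_sym. left. apply Hd2.
          replace (Cexp (s, y) - 0)%C with (Cexp (s, y)) by ring.
          rewrite Cmod_Cexp. exact Hs2. }
      unfold ep in *. lra. }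
  nra.
Qed.

(** * The maximum principle and Schwarz-Pick on the disc *)

Definition mob (a z : C) : C := ((z - a) / (1 - Cconj a * z))%C.

Lemma one_minus_conj_mult_nz (a z : C) : Cmod a * Cmod z < 1 -> (1 - Cconj a * z)%C <> 0.
Proof.
  intros H. apply Cmod_gt_0.
  generalize (Cmod_triangle_rev 1 (Cconj a * z)).
  rewrite Cmod_1, Cmod_mult, Cmod_conj. lra.
Qed.

Lemma disc_mult_lt_1 (a z : C) : in_disc a -> Cmod z <= 1 -> Cmod a * Cmod z < 1.
Proof.
  unfold in_disc. intros Ha Hz. generalize (Cmod_ge_0 a) (Cmod_ge_0 z). nra.
Qed.

Lemma disc_denom_nz (a z : C) : in_disc a -> in_disc z -> (1 - Cconj a * z)%C <> 0.
Proof. intros Ha Hz. apply one_minus_conj_mult_nz, disc_mult_lt_1; auto. apply Rlt_le, Hz. Qed.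

Lemma disc_identity (a z : C) :
  Cmod (1 - Cconj a * z) ^ 2 - Cmod (z - a) ^ 2 = (1 - Cmod z ^ 2) * (1 - Cmod a ^ 2).
Proof.
  rewrite !Cmod2_alt. destruct a as [a1 a2], z as [x y].
  unfold Re, Im, Cminus, Cplus, Copp, Cmult, Cconj, RtoC. simpl. ring.
Qed.

Lemma in_disc_sqr (z : C) : in_disc z -> 0 < 1 - Cmod z ^ 2.
Proof. unfold in_disc. intros H. generalize (Cmod_ge_0 z). nra. Qed.

Lemma Cmod_mob (a z : C) : in_disc a -> in_disc z ->
  1 - Cmod (mob a z) ^ 2 = (1 - Cmod z ^ 2) * (1 - Cmod a ^ 2) / Cmod (1 - Cconj a * z) ^ 2.
Proof.
  intros Ha Hz. unfold mob. assert (N := disc_denom_nz a z Ha Hz).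
  assert (P := proj1 (Cmod_gt_0 _) N).
  rewrite Cmod_div, <- disc_identity by auto. field. lra.
Qed.

Lemma mob_in_disc (a z : C) : in_disc a -> in_disc z -> in_disc (mob a z).
Proof.
  intros Ha Hz. unfold in_disc.
  assert (H : 0 < 1 - Cmod (mob a z) ^ 2).
  { rewrite Cmod_mob by auto. apply Rdiv_lt_0_compat.
    - apply Rmult_lt_0_compat; apply in_disc_sqr; auto.
    - apply pow_lt, Cmod_gt_0, disc_denom_nz; auto. }
  generalize (Cmod_ge_0 (mob a z)). nra.
Qed.

Lemma in_disc_opp (a : C) : in_disc a -> in_disc (- a)%C.
Proof. unfold in_disc. now rewrite Cmod_opp. Qed.

Lemma mob_opp_mob (a z : C) : in_disc a -> in_disc z -> mob (- a) (mob a z) = z.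
Proof.
  intros Ha Hz. unfold mob. rewrite Copp_conj.
  assert (N := disc_denom_nz a z Ha Hz).
  assert (N2 := disc_denom_nz a a Ha Ha).
  field. split; auto.
  replace (1 - Cconj a * z - - Cconj a * (z - a))%C with (1 - Cconj a * a)%C by ring. auto.
Qed.

Lemma mob_mob_opp (a z : C) : in_disc a -> in_disc z -> mob a (mob (- a) z) = z.
Proof.
  intros Ha Hz. assert (H := mob_opp_mob (- a) z (in_disc_opp a Ha) Hz).
  replace (- - a)%C with a in H by ring. exact H.
Qed.

Lemma cderiv_mob (a z : C) : in_disc a -> in_disc z ->
  cderiv (mob a) z ((1 - Cconj a * a) / ((1 - Cconj a * z) * (1 - Cconj a * z)))%C.
Proof.
  intros Ha Hz. unfold mob.
  replace (1 - Cconj a * a)%C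
    with ((1 - 0) * (1 - Cconj a * z) - (z - a) * (0 - (0 * z + Cconj a * 1)))%C by ring.
  apply (cderiv_div (fun z => z - a)%C (fun z => 1 - Cconj a * z)%C).
  - apply cderiv_minus; [apply cderiv_id|apply cderiv_const].
  - apply cderiv_minus; [apply cderiv_const|].
    apply (cderiv_mult (fun _ => Cconj a) (fun w => w)); [apply cderiv_const|apply cderiv_id].
  - apply disc_denom_nz; auto.
Qed.

Lemma cdiff_mob (a z : C) : in_disc a -> in_disc z -> cdiff (mob a) z.
Proof. intros Ha Hz. eexists. apply cderiv_mob; auto. Qed.

(** Moebius maps carry a neighbourhood of the unit circle close to it, so boundary hypotheses
    survive a change of centre. *)
Lemma mob_boundary (a : C) (eta : R) : in_disc a -> eta < 1 ->
  exists r, r < 1 /\ forall z, r < Cmod z < 1 -> eta < Cmod (mob a z).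
Proof.
  intros Ha He. set (t := Rmax eta 0).
  assert (Ht0 : 0 <= t) by apply Rmax_r. assert (Ht1 : eta <= t) by apply Rmax_l.
  assert (Ht2 : t < 1) by (unfold t; apply Rmax_lub_lt; lra).
  set (A := Cmod a). assert (HA : 0 <= A < 1) by (split; [apply Cmod_ge_0|exact Ha]).
  (* Chosen so that [k * (1 - A ^ 2) <= (1 - t ^ 2) * (1 - A) ^ 2]; the denominator in [Cmod_mob] is
     at least [(1 - A) ^ 2]. *)
  set (k := (1 - t ^ 2) * (1 - A) / 2).
  assert (Hk : 0 < k) by (unfold k; apply Rdiv_lt_0_compat; [apply Rmult_lt_0_compat; nra|lra]).
  assert (Hk1 : k < 1) by (unfold k; nra).
  exists (1 - k / 2). split; [lra|]. intros z [Hz1 Hz2].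
  assert (M := Cmod_mob a z Ha Hz2). fold A in M.
  assert (N := disc_denom_nz a z Ha Hz2).
  set (D := Cmod (1 - Cconj a * z)) in *.
  assert (HD : 1 - A <= D).
  { generalize (Cmod_triangle_rev 1 (Cconj a * z)).
    rewrite Cmod_1, Cmod_mult, Cmod_conj. fold A D. nra. }
  set (Z := Cmod z) in *.
  assert (HZ : 1 - Z ^ 2 < k) by nra.
  assert (HZ0 : 0 <= 1 - Z ^ 2) by nra.
  assert (LM : (1 - Z ^ 2) * (1 - A ^ 2) / D ^ 2 < 1 - t ^ 2).
  { apply Rlt_div_l; [apply pow_lt; lra|].
    apply Rlt_le_trans with ((1 - t ^ 2) * (1 - A) ^ 2).
    - apply Rlt_le_trans with (k * (1 - A ^ 2)).
      + apply Rmult_lt_compat_r; nra.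
      + unfold k. replace (1 - A ^ 2) with ((1 - A) * (1 + A)) by ring.
        replace ((1 - t ^ 2) * (1 - A) / 2 * ((1 - A) * (1 + A)))
          with (((1 - t ^ 2) * (1 - A) ^ 2) * ((1 + A) / 2)) by field.
        rewrite <- (Rmult_1_r ((1 - t ^ 2) * (1 - A) ^ 2)) at 2.
        apply Rmult_le_compat_l; [apply Rmult_le_pos; nra|lra].
    - apply Rmult_le_compat_l; nra. }
  rewrite <- M in LM. generalize (Cmod_ge_0 (mob a z)). nra.
Qed.

(** The increment from [e] is exactly [g w * (w - e)], so continuity of [g] alone gives the
    derivative [g e]. A linear factor thus repairs an exceptional point. *)
Lemma cdiff_mult_vanishing (g : C -> C) (e : C) :
  ccont g e -> cdiff (fun z => g z * (z - e))%C e.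
Proof.
  intros H. exists (g e). intros eps He. destruct (H eps He) as [d [Hd Hw]].
  exists d. split; auto. intros w Hwe.
  replace (g w * (w - e) - g e * (e - e) - g e * (w - e))%C
    with ((g w - g e) * (w - e))%C by ring.
  rewrite Cmod_mult. apply Rmult_le_compat_r; [apply Cmod_ge_0|]. left. auto.
Qed.

(** The point [e] is approached along [e + t] with small [t > 0], which avoids both exceptional
    points. *)
Lemma ccont_limit_le (F : C -> C) (e e1 e2 : C) (B : R) :
  in_disc e -> ccont F e ->
  (forall z, in_disc z -> z <> e1 -> z <> e2 -> Cmod (F z) <= B) -> Cmod (F e) <= B.
Proof.
  intros He Hc H. destruct (Rle_lt_dec (Cmod (F e)) B) as [|N]; auto. exfalso.
  destruct (Hc (Cmod (F e) - B)) as [d [Hd Hw]]; [lra|].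
  assert (Hx : forall x y, exists m, 0 < m /\ forall t : R, 0 < t < m -> (x + RtoC t)%C <> y).
  { intros x y. destruct (Ceq_dec x y) as [->|NE].
    - exists 1. split; [lra|]. intros t Ht E.
      assert (RtoC t = 0) as E0.
      { transitivity (y + RtoC t - y)%C; [ring|]. rewrite E. ring. }
      apply RtoC_inj in E0. lra.
    - exists (Cmod (y - x)). split.
      + apply Cmod_gt_0, Cminus_eq_contra. auto.
      + intros t Ht E. rewrite <- E in Ht.
        replace (x + RtoC t - x)%C with (RtoC t) in Ht by ring.
        rewrite Cmod_R, Rabs_right in Ht; lra. }
  destruct (Hx e e1) as [m1 [P1 K1]]. destruct (Hx e e2) as [m2 [P2 K2]].
  set (t := Rmin (Rmin m1 m2) (Rmin d (1 - Cmod e)) / 2).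
  assert (Pt : 0 < Rmin (Rmin m1 m2) (Rmin d (1 - Cmod e))).
  { unfold in_disc in He. repeat apply Rmin_pos; lra. }
  assert (T1 : t < m1).
  { generalize (Rmin_l (Rmin m1 m2) (Rmin d (1 - Cmod e))) (Rmin_l m1 m2). unfold t. lra. }
  assert (T2 : t < m2).
  { generalize (Rmin_l (Rmin m1 m2) (Rmin d (1 - Cmod e))) (Rmin_r m1 m2). unfold t. lra. }
  assert (T3 : t < d).
  { generalize (Rmin_r (Rmin m1 m2) (Rmin d (1 - Cmod e))) (Rmin_l d (1 - Cmod e)). unfold t. lra. }
  assert (T4 : t < 1 - Cmod e).
  { generalize (Rmin_r (Rmin m1 m2) (Rmin d (1 - Cmod e))) (Rmin_r d (1 - Cmod e)). unfold t. lra. }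
  assert (T0 : 0 < t) by (unfold t; lra).
  assert (Ct : Cmod (RtoC t) = t) by (rewrite Cmod_R, Rabs_right; lra).
  assert (L : Cmod (F (e + RtoC t)%C) <= B).
  { apply H; [|apply K1; lra|apply K2; lra]. unfold in_disc.
    generalize (Cmod_triangle e (RtoC t)). lra. }
  specialize (Hw (e + RtoC t)%C).
  replace (e + RtoC t - e)%C with (RtoC t) in Hw by ring. rewrite Ct in Hw.
  specialize (Hw T3). generalize (Cmod_triangle_rev (F e) (F (e + RtoC t)%C)).
  rewrite Cmod_minus_sym. lra.
Qed.

(* Applying the maximum principle to [F^n (z - e1) (z - e2)] and letting [n] tend to infinity
   shows that the two exceptional points do no harm. *)
Lemma max_modulus_center (F : C -> C) (e1 e2 : C) (B : R) :
  e1 <> 0 -> e2 <> 0 -> (forall z, in_disc z -> ccont F z) ->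
  (forall z, in_disc z -> z <> e1 -> z <> e2 -> cdiff F z) -> 0 <= B ->
  (forall eps, 0 < eps -> exists r, r < 1 /\ forall z, r < Cmod z < 1 -> Cmod (F z) <= B + eps) ->
  Cmod (F 0) <= B.
Proof.
  intros N1 N2 Hc Hd HB Hb.
  destruct (Rle_lt_dec (Cmod (F 0)) B) as [|N]; auto. exfalso.
  (* A bound strictly between [B] and [M]: it is valid near the unit circle, and [(M / B') ^ n] is
     unbounded. *)
  set (M := Cmod (F 0)) in *. set (B' := B + (M - B) / 2).
  destruct (Hb ((M - B) / 2)) as [r [Hr Hz]]; [lra|]. fold B' in Hz.
  assert (HB' : 0 < B' < M) by (unfold B'; lra).
  set (r1 := (1 + Rmax r 0) / 2).
  assert (R0 := Rmax_r r 0). assert (R1 := Rmax_l r 0).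
  assert (R2 : Rmax r 0 < 1) by (apply Rmax_lub_lt; lra).
  set (K := (1 + Cmod e1) * (1 + Cmod e2)).
  assert (HK : forall n, M ^ n * (Cmod e1 * Cmod e2) <= B' ^ n * K).
  { intros n.
    set (H := fun z => ((F z) ^ n * (z - e1) * (z - e2))%C).
    assert (EH : Cmod (H 0) = M ^ n * (Cmod e1 * Cmod e2)).
    { unfold H. rewrite !Cmod_mult, Cmod_pow. fold M.
      replace (0 - e1)%C with (- e1)%C by ring. replace (0 - e2)%C with (- e2)%C by ring.
      rewrite !Cmod_opp. ring. }
    rewrite <- EH.
    assert (HD : forall z, in_disc z -> cdiff H z).
    { intros z Dz. unfold H.
      assert (Cz : ccont (fun w => F w ^ n)%C z) by (apply ccont_pow; auto).
      assert (Ca : forall a, cdiff (fun w => w - a)%C z)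
        by (intros a; apply cdiff_minus; [apply cdiff_id|apply cdiff_const]).
      destruct (Ceq_dec z e2) as [E2|E2].
      { rewrite <- E2. apply (cdiff_mult_vanishing (fun z => F z ^ n * (z - e1))%C).
        apply ccont_mult; auto. apply cdiff_ccont. auto. }
      apply (cdiff_mult (fun z => F z ^ n * (z - e1))%C); auto.
      destruct (Ceq_dec z e1) as [E1|E1].
      { rewrite <- E1. apply (cdiff_mult_vanishing (fun z => F z ^ n)%C); auto. }
      apply (cdiff_mult (fun z => F z ^ n)%C); auto. apply cdiff_pow. auto. }
    apply (max_modulus_circle H r1); [unfold r1; lra| | |].
    - intros z Lz _. apply HD. unfold in_disc. unfold r1 in Lz. lra.
    - apply cdiff_ccont, HD. unfold in_disc. rewrite Cmod_0. lra.
    - intros z Ez. unfold H, K. rewrite !Cmod_mult, Cmod_pow, Rmult_assoc.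
      assert (La : forall a, Cmod (z - a) <= 1 + Cmod a).
      { intros a. unfold Cminus. eapply Rle_trans; [apply Cmod_triangle|].
        rewrite Cmod_opp. rewrite Ez. unfold r1. lra. }
      apply Rmult_le_compat.
      + apply pow_le, Cmod_ge_0.
      + apply Rmult_le_pos; apply Cmod_ge_0.
      + apply pow_incr. split; [apply Cmod_ge_0|]. apply Hz. rewrite Ez. unfold r1. lra.
      + apply Rmult_le_compat; auto; apply Cmod_ge_0. }
  apply Cmod_gt_0 in N1. apply Cmod_gt_0 in N2.
  assert (P : 0 < Cmod e1 * Cmod e2) by (apply Rmult_lt_0_compat; auto).
  destruct (Pow_x_infinity (M / B')) with (b := K / (Cmod e1 * Cmod e2) + 1) as [n Hn].
  { rewrite Rabs_right.
    - apply Rlt_div_r; lra.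
    - apply Rle_ge, Rlt_le, Rdiv_lt_0_compat; lra. }
  specialize (Hn n (Nat.le_refl n)).
  assert (PB : 0 < B' ^ n) by (apply pow_lt; lra).
  rewrite Rabs_right in Hn.
  2:{ apply Rle_ge, pow_le, Rlt_le, Rdiv_lt_0_compat; lra. }
  unfold Rdiv in Hn at 1. rewrite Rpow_mult_distr, pow_inv in Hn.
  assert (L2 : M ^ n * / B' ^ n <= K / (Cmod e1 * Cmod e2)).
  { apply (proj1 (Rle_div_r _ _ _ P)). replace (M ^ n * / B' ^ n * (Cmod e1 * Cmod e2))
      with ((M ^ n * (Cmod e1 * Cmod e2)) / B' ^ n) by (field; lra).
    apply Rle_div_l; [lra|]. generalize (HK n). lra. }
  lra.
Qed.

(** A Moebius change of variable moves any non-exceptional point to 0 and keeps the exceptional ones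
    away from 0; continuity then covers the exceptional points. Two of them are allowed because
    Schwarz-Pick, applied to a difference quotient, forms a second one. *)
Theorem max_modulus_disc (F : C -> C) (e1 e2 : C) (B : R) :
  in_disc e1 -> in_disc e2 -> (forall z, in_disc z -> ccont F z) ->
  (forall z, in_disc z -> z <> e1 -> z <> e2 -> cdiff F z) -> 0 <= B ->
  (forall eps, 0 < eps -> exists r, r < 1 /\ forall z, r < Cmod z < 1 -> Cmod (F z) <= B + eps) ->
  forall z, in_disc z -> Cmod (F z) <= B.
Proof.
  intros D1 D2 Hc Hd HB Hb.
  assert (Main : forall a, in_disc a -> a <> e1 -> a <> e2 -> Cmod (F a) <= B).
  { intros a Da Na1 Na2.
    assert (Da' := in_disc_opp a Da).
    assert (E0 : mob (- a) 0 = a).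
    { unfold mob. rewrite Copp_conj. field. }
    rewrite <- E0.
    assert (D0 : in_disc 0) by (unfold in_disc; rewrite Cmod_0; lra).
    assert (Hinj : forall z e, in_disc z -> in_disc e -> z <> mob a e -> mob (- a) z <> e).
    { intros z e Dz De Nz E. apply Nz. rewrite <- E. symmetry. apply mob_mob_opp; auto. }
    assert (Hnz : forall e, in_disc e -> a <> e -> mob a e <> 0).
    { intros e De Ne E. apply Ne. rewrite <- E0, <- E. apply mob_opp_mob; auto. }
    apply (max_modulus_center (fun z => F (mob (- a) z)) (mob a e1) (mob a e2)); auto.
    - intros z Dz. apply (ccont_comp F (mob (- a))).
      + apply cdiff_ccont, cdiff_mob; auto.
      + apply Hc, mob_in_disc; auto.
    - intros z Dz M1 M2. apply (cdiff_comp F (mob (- a))).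
      + apply cdiff_mob; auto.
      + apply Hd; auto. apply mob_in_disc; auto.
    - intros eps He. destruct (Hb eps He) as [r [Hr Hz]].
      destruct (mob_boundary (- a) r Da' Hr) as [r' [Hr' Hz']].
      exists r'. split; auto. intros z Lz. apply Hz. split; auto.
      apply mob_in_disc; auto. apply Lz. }
  intros z Dz. apply (ccont_limit_le F z e1 e2); auto.
Qed.

(** The value [l] is meant to be the derivative of [f] at [a], which makes the quotient continuous
    there; [a] is then treated as an exceptional point. *)
Definition dquot (f : C -> C) (a l z : C) : C :=
  if Ceq_dec z a then l else ((f z - f a) / (z - a))%C.

Lemma dquot_neq (f : C -> C) (a l z : C) : z <> a -> dquot f a l z = ((f z - f a) / (z - a))%C.
Proof. intros N. unfold dquot. destruct (Ceq_dec z a); [contradiction|auto]. Qed.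

Lemma dquot_eq (f : C -> C) (a l : C) : dquot f a l a = l.
Proof. unfold dquot. destruct (Ceq_dec a a); [auto|contradiction]. Qed.

Lemma ccont_ext (f g : C -> C) (z : C) (d : R) :
  0 < d -> (forall w, Cmod (w - z) < d -> f w = g w) -> ccont f z -> ccont g z.
Proof.
  intros Hd E H eps He. destruct (H eps He) as [d' [Hd' Hw]].
  exists (Rmin d d'). split; [apply Rmin_pos; auto|]. intros w Hwz.
  rewrite <- !E. apply Hw.
  - eapply Rlt_le_trans; [exact Hwz|apply Rmin_r].
  - replace (z - z)%C with (RtoC 0) by ring. rewrite Cmod_0. exact Hd.
  - eapply Rlt_le_trans; [exact Hwz|apply Rmin_l].
Qed.

Lemma dquot_local (f : C -> C) (a l z : C) : z <> a -> 0 < Cmod (z - a) /\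
  forall w, Cmod (w - z) < Cmod (z - a) -> ((f w - f a) / (w - a))%C = dquot f a l w.
Proof.
  intros N. split; [apply Cmod_gt_0, Cminus_eq_contra, N|].
  intros w Hw. symmetry. apply dquot_neq. intros ->. rewrite Cmod_minus_sym in Hw. lra.
Qed.

Lemma cdiff_dquot (f : C -> C) (a l z : C) : z <> a -> cdiff f z -> cdiff (dquot f a l) z.
Proof.
  intros N Hf. destruct (dquot_local f a l z N) as [P E].
  destruct (cdiff_div (fun w => f w - f a)%C (fun w => w - a)%C z) as [m Hm].
  - apply cdiff_minus; auto. apply cdiff_const.
  - apply cdiff_minus; [apply cdiff_id|apply cdiff_const].
  - apply Cminus_eq_contra, N.
  - exists m. eapply cderiv_ext; [exact P|exact E|exact Hm].
Qed.

Lemma ccont_dquot (f : C -> C) (a l z : C) :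
  cderiv f a l -> ccont f z -> ccont (dquot f a l) z.
Proof.
  intros Hl Hf. destruct (Ceq_dec z a) as [->|N].
  - intros eps He. destruct (Hl (eps / 2)) as [d [Hd Hw]]; [lra|].
    exists d. split; auto. intros w Hwa. rewrite dquot_eq.
    destruct (Ceq_dec w a) as [->|Nw].
    + rewrite dquot_eq. replace (l - l)%C with (RtoC 0) by ring. rewrite Cmod_0. lra.
    + rewrite dquot_neq by auto. assert (Nwa := Cminus_eq_contra _ _ Nw).
      replace ((f w - f a) / (w - a) - l)%C with ((f w - f a - l * (w - a)) / (w - a))%C
        by (field; auto).
      rewrite Cmod_div by auto. assert (P := proj1 (Cmod_gt_0 _) Nwa).
      apply Rle_lt_trans with (eps / 2); [|lra]. apply Rle_div_l; auto.
  - destruct (dquot_local f a l z N) as [P E].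
    eapply ccont_ext; [exact P|exact E|].
    apply (ccont_div (fun w => f w - f a)%C (fun w => w - a)%C).
    + apply ccont_minus; auto. apply ccont_const.
    + apply ccont_minus; [apply ccont_id|apply ccont_const].
    + apply Cminus_eq_contra, N.
Qed.

(** Away from [a], the function [F] is [mob (K a) (K w) / mob a w]; written with [dquot] it is
    continuous at [a] as well. Its denominator tends to 1 in modulus at the unit circle, so the
    maximum principle bounds it by 1. The point [e], where [K] is only assumed continuous, makes
    room for [K] of the form h(z)/z. *)
Theorem schwarz_pick (K : C -> C) (e a z : C) :
  in_disc e -> (forall w, in_disc w -> ccont K w) ->
  (forall w, in_disc w -> w <> e -> cdiff K w) ->
  (forall w, in_disc w -> in_disc (K w)) ->
  in_disc a -> a <> e -> in_disc z ->
  Cmod (K z - K a) * Cmod (1 - Cconj a * z) <= Cmod (z - a) * Cmod (1 - Cconj (K a) * K z).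
Proof.
  intros De Hc Hd HK Da Na Dz.
  destruct (Hd a Da Na) as [l Hl].
  set (F := fun w => (dquot K a l w * ((1 - Cconj a * w) / (1 - Cconj (K a) * K w)))%C).
  assert (HF : forall w, in_disc w -> Cmod (F w) <= 1).
  { apply (max_modulus_disc F e a); auto.
    - intros w Dw. apply ccont_mult; [apply ccont_dquot; auto|].
      apply (ccont_div (fun w => 1 - Cconj a * w)%C (fun w => 1 - Cconj (K a) * K w)%C).
      + apply ccont_minus; [apply ccont_const|apply ccont_mult; [apply ccont_const|apply ccont_id]].
      + apply ccont_minus; [apply ccont_const|apply ccont_mult; [apply ccont_const|auto]].
      + apply disc_denom_nz; auto.
    - intros w Dw N1 N2. apply cdiff_mult; [apply cdiff_dquot; auto|].
      apply (cdiff_div (fun w => 1 - Cconj a * w)%C (fun w => 1 - Cconj (K a) * K w)%C).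
      + apply cdiff_minus; [apply cdiff_const|apply cdiff_mult; [apply cdiff_const|apply cdiff_id]].
      + apply cdiff_minus; [apply cdiff_const|apply cdiff_mult; [apply cdiff_const|auto]].
      + apply disc_denom_nz; auto.
    - lra.
    - intros eps He.
      (* Where [|mob a w| > 1 / (1 + eps)], the quotient is at most [1 + eps]. *)
      destruct (mob_boundary a (/ (1 + eps)) Da) as [r [Hr Hw]].
      { rewrite <- Rinv_1. apply Rinv_lt_contravar; lra. }
      exists r. split; auto. intros w Lw. specialize (Hw w Lw).
      assert (Dw : in_disc w) by apply Lw.
      assert (Pe : 0 < / (1 + eps)) by (apply Rinv_0_lt_compat; lra).
      assert (Nm : mob a w <> 0) by (apply Cmod_gt_0; lra).
      assert (Nw : w <> a).
      { intros ->. apply Nm. unfold mob. replace (a - a)%C with (RtoC 0) by ring.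
        unfold Cdiv. apply Cmult_0_l. }
      assert (EF : F w = (mob (K a) (K w) / mob a w)%C).
      { unfold F. rewrite dquot_neq by auto. unfold mob. field.
        repeat split; try (apply disc_denom_nz; auto); apply Cminus_eq_contra; auto. }
      rewrite EF, Cmod_div by auto.
      assert (L1 := mob_in_disc (K a) (K w) (HK a Da) (HK w Dw)). unfold in_disc in L1.
      apply Rle_div_l; [lra|].
      apply Rmult_lt_compat_l with (r := 1 + eps) in Hw; [|lra].
      rewrite Rinv_r in Hw; lra. }
  destruct (Ceq_dec z a) as [->|Nz].
  { replace (K a - K a)%C with (RtoC 0) by ring. replace (a - a)%C with (RtoC 0) by ring.
    rewrite Cmod_0. lra. }
  specialize (HF z Dz). unfold F in HF. rewrite dquot_neq in HF by auto.
  assert (N1 := Cminus_eq_contra _ _ Nz). assert (N2 := disc_denom_nz _ _ (HK a Da) (HK z Dz)).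
  rewrite Cmod_mult, !Cmod_div in HF by auto.
  apply Cmod_gt_0 in N1. apply Cmod_gt_0 in N2.
  replace (Cmod (K z - K a) / Cmod (z - a) * (Cmod (1 - Cconj a * z) / Cmod (1 - Cconj (K a) * K z)))
    with (Cmod (K z - K a) * Cmod (1 - Cconj a * z) / (Cmod (z - a) * Cmod (1 - Cconj (K a) * K z)))
    in HF by (field; lra).
  apply Rle_div_l in HF; [lra|]. apply Rmult_lt_0_compat; auto.
Qed.

(** Rotating both points to one ray does not increase their pseudo-hyperbolic distance: numerator
    and denominator, squared, both lose the same amount [2 * T >= 0], and [s <= 1]. *)
Lemma pseudo_hyp_moduli (x y : C) (s : R) :
  0 <= s <= 1 -> Cmod x * Cmod y <= 1 -> Cmod (x - y) <= s * Cmod (1 - Cconj y * x) ->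
  Rabs (Cmod x - Cmod y) <= s * (1 - Cmod x * Cmod y).
Proof.
  intros Hs Hxy H.
  set (X := Cmod x) in *. set (Y := Cmod y) in *.
  set (T := X * Y - Re (x * Cconj y)).
  assert (HT : 0 <= T).
  { unfold T. generalize (Rle_abs (Re (x * Cconj y))) (re_le_Cmod (x * Cconj y)).
    rewrite Cmod_mult, Cmod_conj. fold X Y. lra. }
  assert (EX := Cmod2_alt x). assert (EY := Cmod2_alt y). fold X in EX. fold Y in EY.
  assert (E1 : Cmod (x - y) ^ 2 = (X - Y) ^ 2 + 2 * T).
  { rewrite Cmod2_alt. unfold T. replace ((X - Y) ^ 2) with (X ^ 2 + Y ^ 2 - 2 * (X * Y)) by ring.
    rewrite EX, EY. destruct x, y. unfold Re, Im, Cminus, Cplus, Copp, Cmult, Cconj. simpl. ring. }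
  assert (E2 : Cmod (1 - Cconj y * x) ^ 2 = (1 - X * Y) ^ 2 + 2 * T).
  { rewrite Cmod2_alt. unfold T. replace ((1 - X * Y) ^ 2) with (1 + X ^ 2 * Y ^ 2 - 2 * (X * Y)) by ring.
    rewrite EX, EY. destruct x, y. unfold Re, Im, Cminus, Cplus, Copp, Cmult, Cconj, RtoC. simpl. ring. }
  assert (H2 : Cmod (x - y) ^ 2 <= s ^ 2 * Cmod (1 - Cconj y * x) ^ 2).
  { rewrite <- Rpow_mult_distr. apply pow_incr. split; [apply Cmod_ge_0|exact H]. }
  rewrite E1, E2 in H2.
  assert (H3 : (X - Y) ^ 2 <= (s * (1 - X * Y)) ^ 2).
  { rewrite Rpow_mult_distr. assert (s ^ 2 <= 1) by nra. nra. }

  assert (P : 0 <= s * (1 - X * Y)) by (apply Rmult_le_pos; lra).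
  apply Rabs_le. split; nra.
Qed.

(** * Maps omitting a value *)

Lemma in_disc_0 : in_disc 0.
Proof. unfold in_disc. rewrite Cmod_0. lra. Qed.

(** Schwarz's lemma: near the unit circle [|h z / z| < 1 / |z|], and the maximum principle carries
    the bound inside, including the value [l] at 0. *)
Lemma schwarz_dquot (h : C -> C) (l : C) :
  (forall z, in_disc z -> cdiff h z) -> (forall z, in_disc z -> in_disc (h z)) ->
  h 0 = 0 -> cderiv h 0 l -> forall z, in_disc z -> Cmod (dquot h 0 l z) <= 1.
Proof.
  intros Hd HD H0 Hl.
  apply (max_modulus_disc (dquot h 0 l) 0 0); try apply in_disc_0; [| |lra|].
  - intros z Dz. apply ccont_dquot; auto. apply cdiff_ccont; auto.
  - intros z Dz N _. apply cdiff_dquot; auto.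
  - intros eps He. exists (/ (1 + eps)).
    assert (P : 0 < / (1 + eps)) by (apply Rinv_0_lt_compat; lra).
    split; [rewrite <- Rinv_1; apply Rinv_lt_contravar; lra|].
    intros z [Lz Dz]. assert (Nz : z <> 0) by (apply Cmod_gt_0; lra).
    rewrite dquot_neq, H0 by auto.
    replace (h z - 0)%C with (h z) by ring. replace (z - 0)%C with z by ring.
    rewrite Cmod_div by auto. apply Rle_div_l; [lra|].
    generalize (HD z Dz). unfold in_disc. intros L.
    apply Rmult_lt_compat_l with (r := 1 + eps) in Lz; [|lra]. rewrite Rinv_r in Lz; lra.
Qed.

(* Put [rho = (1 + rho0) / 2], [m = 2 rho / (1 + rho^2)], [r = (1 + m) / 2] and
   [a = 2 r / (1 + r^2)].  If [|l| > a], Schwarz-Pick for [h(z)/z] gives [|h| >= r^2 > m] on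
   [|z| = r], so that [h] stays at pseudo-hyperbolic distance at least [rho] from [w]; if [h] omits
   [w] this contradicts the maximum principle for [1 / mob w h], since [h 0 = 0]. *)
Lemma omitted_value_bound (rho0 : R) : 0 <= rho0 < 1 ->
  exists c, c < 1 /\ forall (h : C -> C) (l w : C),
    (forall z, in_disc z -> cdiff h z) -> (forall z, in_disc z -> in_disc (h z)) ->
    h 0 = 0 -> cderiv h 0 l -> Cmod w <= rho0 -> (forall z, in_disc z -> h z <> w) ->
    Cmod l <= c.
Proof.
  intros Hr0. set (rho := (1 + rho0) / 2).
  assert (Hrho : rho0 < rho < 1 /\ 0 < rho) by (unfold rho; lra).
  set (m := 2 * rho / (1 + rho ^ 2)).
  assert (Em : m * (1 + rho ^ 2) = 2 * rho) by (unfold m; field; nra).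
  assert (Hm : 0 < m < 1).
  { split.
    - unfold m. apply Rdiv_lt_0_compat; nra.
    - unfold m. apply Rlt_div_l; nra. }
  set (r := (1 + m) / 2). assert (Hr : 0 < r < 1) by (unfold r; lra).
  assert (Hrm : m < r ^ 2) by (unfold r; nra).
  set (a := 2 * r / (1 + r ^ 2)).
  assert (Ea : a * (1 + r ^ 2) = 2 * r) by (unfold a; field; nra).
  assert (Ha : 0 < a < 1).
  { split.
    - unfold a. apply Rdiv_lt_0_compat; nra.
    - unfold a. apply Rlt_div_l; nra. }
  exists a. split; [lra|].
  intros h l w Hd HD H0 Hl Hw Hom.
  destruct (Rle_lt_dec (Cmod l) a) as [|N]; auto. exfalso.
  assert (HK := schwarz_dquot h l Hd HD H0 Hl).
  (* The quotient h(z)/z is only known to lie in the closed disc. Scaling by [t < 1] brings it into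
     the open one and makes the modulus at 0 exactly [a]. *)
  set (t := a / Cmod l).
  assert (Ht : 0 < t < 1).
  { unfold t. split; [apply Rdiv_lt_0_compat; lra|apply Rlt_div_l; lra]. }
  assert (Et : t * Cmod l = a) by (unfold t; field; lra).
  set (K := fun z => (RtoC t * dquot h 0 l z)%C).
  assert (MK : forall z, Cmod (K z) = t * Cmod (dquot h 0 l z)).
  { intros z. unfold K. rewrite Cmod_mult, Cmod_R, Rabs_right; lra. }
  assert (DK : forall z, in_disc z -> in_disc (K z)).
  { intros z Dz. unfold in_disc. rewrite MK. generalize (HK z Dz) (Cmod_ge_0 (dquot h 0 l z)). nra. }
  assert (K0 : Cmod (K 0) = a) by (rewrite MK, dquot_eq; auto).
  assert (Hlow : forall z, Cmod z = r -> r ^ 2 <= Cmod (h z)).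
  { intros z Ez. assert (Dz : in_disc z) by (unfold in_disc; lra).
    assert (Nz : z <> 0) by (apply Cmod_gt_0; lra).
    assert (SP : Cmod (K 0 - K z) * Cmod (1 - Cconj z * 0)
                 <= Cmod (0 - z) * Cmod (1 - Cconj (K z) * K 0)).
    { apply (schwarz_pick K 0); auto; try apply in_disc_0.
      - intros u Du. apply ccont_mult; [apply ccont_const|].
        apply ccont_dquot; auto. apply cdiff_ccont; auto.
      - intros u Du Nu. apply cdiff_mult; [apply cdiff_const|]. apply cdiff_dquot; auto. }
    replace (1 - Cconj z * 0)%C with (RtoC 1) in SP by ring.
    replace (0 - z)%C with (- z)%C in SP by ring.
    rewrite Cmod_1, Cmod_opp, Rmult_1_r, Ez in SP.
    apply pseudo_hyp_moduli in SP; [|lra|].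
    2:{ generalize (DK z Dz) (Cmod_ge_0 (K z)). unfold in_disc. rewrite K0. nra. }
    rewrite K0 in SP. set (X := Cmod (K z)) in *.
    assert (L1 : a - X <= r * (1 - a * X)) by (eapply Rle_trans; [apply Rle_abs|exact SP]).
    (* The constant [a] satisfies [(a - r) / (1 - a * r) = r]: a point within pseudo-hyperbolic
       distance [r] of one of modulus [a] has modulus at least [r]. *)
    assert (L2 : r <= X).
    { assert (Q1 : (a - X) * (1 + r ^ 2) <= r * (1 - a * X) * (1 + r ^ 2))
        by (apply Rmult_le_compat_r; nra).
      assert (Q2 : 2 * r - X * (1 + r ^ 2) <= r * (1 + r ^ 2) - 2 * r * (r * X)).
      { replace ((a - X) * (1 + r ^ 2)) with (a * (1 + r ^ 2) - X * (1 + r ^ 2)) in Q1 by ring.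
        replace (r * (1 - a * X) * (1 + r ^ 2))
          with (r * (1 + r ^ 2) - a * (1 + r ^ 2) * (r * X)) in Q1 by ring.
        rewrite Ea in Q1. exact Q1. }
      assert (Q3 : r * (1 - r ^ 2) <= X * (1 - r ^ 2)) by nra.
      apply Rmult_le_reg_r with (1 - r ^ 2); nra. }
    assert (L3 : X <= Cmod (dquot h 0 l z)).
    { unfold X. rewrite MK. generalize (Cmod_ge_0 (dquot h 0 l z)). nra. }
    rewrite dquot_neq, H0 in L3 by auto.
    replace (h z - 0)%C with (h z) in L3 by ring. replace (z - 0)%C with z in L3 by ring.
    rewrite Cmod_div, Ez in L3 by auto.
    apply Rle_div_r in L3; [|lra]. nra. }
  assert (Dw : in_disc w) by (unfold in_disc; lra).
  assert (Hq : forall z, Cmod z = r -> rho <= Cmod (mob w (h z))).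
  { intros z Ez. assert (Dz : in_disc z) by (unfold in_disc; lra).
    destruct (Rle_lt_dec rho (Cmod (mob w (h z)))) as [|Lq]; auto. exfalso.
    assert (Nd := disc_denom_nz w (h z) Dw (HD z Dz)).
    unfold mob in Lq. rewrite Cmod_div in Lq by auto.
    apply Cmod_gt_0 in Nd. apply (proj1 (Rlt_div_l _ _ _ Nd)) in Lq.
    apply Rlt_le, pseudo_hyp_moduli in Lq; [|lra|].
    2:{ generalize (disc_mult_lt_1 w (h z) Dw (Rlt_le _ _ (HD z Dz))). lra. }
    set (H := Cmod (h z)) in *. set (W := Cmod w) in *.
    assert (L1 : H - W <= rho * (1 - H * W)) by (eapply Rle_trans; [apply Rle_abs|exact Lq]).
    assert (W0 : 0 <= W) by apply Cmod_ge_0.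
    (* Likewise [m] is the pseudo-hyperbolic double of [rho]: a point within distance [rho] of one
       of modulus at most [rho] has modulus at most [m]. *)
    assert (L2 : H * (1 + rho * W) <= m * (1 + rho * W)).
    { apply Rle_trans with (W + rho); [lra|].
      apply Rmult_le_reg_r with (1 + rho ^ 2); [nra|].
      replace (m * (1 + rho * W) * (1 + rho ^ 2)) with ((m * (1 + rho ^ 2)) * (1 + rho * W)) by ring.
      rewrite Em. assert (0 <= (rho - W) * (1 - rho ^ 2)) by (apply Rmult_le_pos; nra). nra. }
    apply Rmult_le_reg_r in L2; [|nra].
    generalize (Hlow z Ez). fold H. lra. }
  set (F := fun z => (1 / mob w (h z))%C).
  assert (Nq : forall z, in_disc z -> mob w (h z) <> 0).
  { intros z Dz E. apply (Hom z Dz). unfold mob in E.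
    assert (Nd := disc_denom_nz w (h z) Dw (HD z Dz)).
    apply Ceq_minus. transitivity ((h z - w) / (1 - Cconj w * h z) * (1 - Cconj w * h z))%C.
    - field. auto.
    - rewrite E. apply Cmult_0_l. }
  assert (DF : forall z, in_disc z -> cdiff F z).
  { intros z Dz. apply (cdiff_div (fun _ => RtoC 1) (fun z => mob w (h z))); auto.
    - apply cdiff_const.
    - apply (cdiff_comp (mob w) h); auto. apply cdiff_mob; auto. }
  assert (MP : Cmod (F 0) <= / rho).
  { apply (max_modulus_circle F r); [lra| | |].
    - intros z Lz _. apply DF. unfold in_disc. lra.
    - apply cdiff_ccont, DF, in_disc_0.
    - intros z Ez. unfold F. assert (Dz : in_disc z) by (unfold in_disc; lra).
      rewrite Cmod_div, Cmod_1 by auto. unfold Rdiv. rewrite Rmult_1_l.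
      apply Rinv_le_contravar; [lra|auto]. }
  unfold F in MP. rewrite Cmod_div, Cmod_1 in MP by (apply Nq, in_disc_0).
  assert (Pq := proj1 (Cmod_gt_0 _) (Nq 0 in_disc_0)).
  rewrite H0 in *.
  assert (E : Cmod (mob w 0) = Cmod w).
  { unfold mob. replace (1 - Cconj w * 0)%C with (RtoC 1) by ring.
    replace ((0 - w) / 1)%C with (- w)%C by (field; apply C1_nz). apply Cmod_opp. }
  rewrite E in *.
  (* Since [h 0 = 0], [MP] reads [1 / |w| <= 1 / rho], against [|w| <= rho0 < rho]. *)
  assert (rho <= Cmod w); [|lra].
  apply Rle_div_l in MP; [|lra].
  apply Rmult_le_compat_l with (r := rho) in MP; [|lra].
  rewrite <- Rmult_assoc, Rinv_r in MP; lra.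
Qed.

(** * Hyperbolic distance, and contractivity of domains without large discs *)

Lemma pseudo_hyp_mob (z a : C) : pseudo_hyp z a = Cmod (mob a z).
Proof. reflexivity. Qed.

(** The threshold is [tanh R]; it bounds the square because [d_h] is built from the squared
    pseudo-hyperbolic distance. *)
Lemma d_h_lt_iff (w a : C) (R : R) : in_disc w -> in_disc a ->
  d_h w a < R <-> pseudo_hyp w a ^ 2 < (exp (2 * R) - 1) / (exp (2 * R) + 1).
Proof.
  intros Dw Da. unfold d_h. assert (Dm := mob_in_disc a w Da Dw).
  unfold in_disc in Dm.
  rewrite pseudo_hyp_mob. set (p := Cmod (mob a w)) in *.
  assert (P0 : 0 <= p) by apply Cmod_ge_0. assert (P1 : p ^ 2 < 1) by nra.
  assert (P2 : 0 <= p ^ 2) by nra.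
  set (E := exp (2 * R)). assert (PE : 0 < E) by apply exp_pos.
  assert (Q : 0 < (1 + p ^ 2) / (1 - p ^ 2)) by (apply Rdiv_lt_0_compat; lra).
  split; intros H.
  - apply (proj1 (Rlt_div_r _ _ (E + 1) ltac:(lra))).
    assert (L : (1 + p ^ 2) / (1 - p ^ 2) < E).
    { rewrite <- (exp_ln _ Q). apply exp_increasing. lra. }
    apply Rlt_div_l in L; [|lra]. nra.
  - apply Rlt_div_r in H; [|lra].
    assert (L : ln ((1 + p ^ 2) / (1 - p ^ 2)) < 2 * R); [|lra].
    apply exp_lt_inv. rewrite exp_ln by exact Q. fold E.
    apply Rlt_div_l; [lra|]. nra.
Qed.

Lemma mob_self (a : C) : mob a a = 0.
Proof. unfold mob. replace (a - a)%C with (RtoC 0) by ring. unfold Cdiv. apply Cmult_0_l. Qed.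

Lemma RtoC_neq_0 (x : R) : x <> 0 -> RtoC x <> 0.
Proof. intros H E. apply H, RtoC_inj, E. Qed.

(** Moebius maps that move [z0] and [f z0] to 0 turn the hyperbolic derivative at [z0] into the
    modulus of a derivative at 0 ([Elh]). The hyperbolic disc of radius [R] about [f z0] contains a
    point outside [Om], so the normalised map omits a value of modulus at most [sqrt T]. The
    resulting [c] depends on [R] only. *)
Theorem no_large_disc_contractive (Om : C -> Prop) (R : R) :
  (forall z, Om z -> in_disc z) -> 0 < R ->
  ~ (exists a, in_disc a /\ forall w, hyp_disc a R w -> Om w) -> contractive Om.
Proof.
  intros HOm HR Hno f Hf HfO.
  set (E := exp (2 * R)).
  assert (PE : 1 < E) by (unfold E; rewrite <- exp_0; apply exp_increasing; lra).
  set (T := (E - 1) / (E + 1)).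
  assert (HT : 0 < T < 1).
  { unfold T. split; [apply Rdiv_lt_0_compat; lra|apply Rlt_div_l; lra]. }
  destruct (omitted_value_bound (sqrt T)) as [c [Hc Hcore]].
  { split; [apply sqrt_pos|]. rewrite <- sqrt_1. apply sqrt_lt_1; lra. }
  exists c. split; auto. intros z0 l Dz Hl. apply has_cderiv_cderiv in Hl.
  set (b := f z0) in *. assert (Db : in_disc b) by (apply HOm, HfO, Dz).
  assert (Hw : exists w, in_disc w /\ d_h w b < R /\ ~ Om w).
  { apply NNPP. intros Hn. apply Hno. exists b. split; auto. intros w [Dw Lw].
    apply NNPP. intros NO. apply Hn. exists w. auto. }
  destruct Hw as (w & Dw & Lw & NO).
  apply d_h_lt_iff in Lw; auto. fold E T in Lw. rewrite pseudo_hyp_mob in Lw.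
  set (h := fun z => mob b (f (mob (- z0) z))).
  assert (Dz' := in_disc_opp z0 Dz).
  assert (E0 : mob (- z0) 0 = z0).
  { unfold mob. rewrite Copp_conj. field. }
  assert (S1 := in_disc_sqr z0 Dz). assert (S2 := in_disc_sqr b Db).
  assert (Hh : cderiv h 0 ((1 - Cconj (- z0) * (- z0)) / ((1 - Cconj (- z0) * 0) * (1 - Cconj (- z0) * 0))
                 * l * ((1 - Cconj b * b) / ((1 - Cconj b * b) * (1 - Cconj b * b))))%C).
  { apply (cderiv_comp (mob b) (fun z => f (mob (- z0) z))).
    - rewrite E0. apply cderiv_mob; auto.
    - apply (cderiv_comp f (mob (- z0))).
      + rewrite E0. exact Hl.
      + apply cderiv_mob; auto. apply in_disc_0. }
  assert (EM : forall x, (1 - Cconj x * x)%C = RtoC (1 - Cmod x ^ 2)).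
  { intros x. rewrite RtoC_minus, Cmod2_conj. ring. }
  match type of Hh with cderiv _ _ ?L => set (lh := L) in * end.
  assert (Elh : Cmod lh = (1 - Cmod z0 ^ 2) * Cmod l / (1 - Cmod b ^ 2)).
  { unfold lh. rewrite !EM, Cmod_opp.
    replace (1 - Cconj (- z0) * 0)%C with (RtoC 1) by ring.
    assert (N2 : RtoC (1 - Cmod b ^ 2) <> 0) by (apply RtoC_neq_0; lra).
    replace (RtoC (1 - Cmod z0 ^ 2) / (1 * 1) * l
      * (RtoC (1 - Cmod b ^ 2) / (RtoC (1 - Cmod b ^ 2) * RtoC (1 - Cmod b ^ 2))))%C
      with (RtoC (1 - Cmod z0 ^ 2) * l / RtoC (1 - Cmod b ^ 2))%C.
    2:{ field. auto. }
    rewrite Cmod_div, Cmod_mult, !Cmod_R, !Rabs_right by (auto; lra). reflexivity. }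
  rewrite <- Elh.
  assert (Df : forall z, in_disc z -> in_disc (f (mob (- z0) z)))
    by (intros; apply HOm, HfO, mob_in_disc; auto).
  apply (Hcore h lh (mob b w)).
  - intros z D. apply (cdiff_comp (mob b) (fun z => f (mob (- z0) z))).
    + apply (cdiff_comp f (mob (- z0))); [apply cdiff_mob; auto|].
      destruct (Hf (mob (- z0) z)) as [l' Hl']; [apply mob_in_disc; auto|].
      exists l'. apply has_cderiv_cderiv, Hl'.
    + apply cdiff_mob; auto.
  - intros z D. apply mob_in_disc; auto.
  - unfold h. rewrite E0. apply mob_self.
  - exact Hh.
  - apply Rsqr_incr_0_var; [|apply sqrt_pos]. rewrite Rsqr_sqrt by lra. unfold Rsqr. nra.
  - intros z D Eq. apply NO. unfold h in Eq.
    rewrite <- (mob_opp_mob b w), <- Eq, mob_opp_mob by auto.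
    apply HfO, mob_in_disc; auto.
Qed.

(** * Chains of discs *)

(** A finite chain is a length with a total sequence whose entries beyond the length are meaningless
    and may be overwritten by an extension. *)
Definition chain {A : Type} (Rel : A -> A -> Prop) (c : nat * (nat -> A)) : Prop :=
  forall n, (n < fst c)%nat -> Rel (snd c n) (snd c (S n)).
Definition extends {A : Type} (c c' : nat * (nat -> A)) : Prop :=
  (fst c <= fst c')%nat /\ forall n, (n <= fst c)%nat -> snd c' n = snd c n.
Definition end_of {A : Type} (c : nat * (nat -> A)) : A := snd c (fst c).

Lemma chain_extend_step {A : Type} (Rel : A -> A -> Prop) (c : nat * (nat -> A)) (b : A) :
  chain Rel c -> Rel (end_of c) b ->
  exists c', chain Rel c' /\ extends c c' /\ (fst c < fst c')%nat /\ end_of c' = b.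
Proof.
  destruct c as [N P]. unfold chain, extends, end_of. cbn [fst snd]. intros Hc Hb.
  exists (S N, fun n => if le_dec n N then P n else b). cbn [fst snd]. repeat split; try lia.
  - intros n Hn. destruct (le_dec n N) as [L|L]; [|lia].
    destruct (le_dec (S n) N) as [L'|L']; [apply Hc; lia|].
    replace n with N by lia. exact Hb.
  - intros n Hn. destruct (le_dec n N); [auto|lia].
  - destruct (le_dec (S N) N); [lia|auto].
Qed.

Lemma chain_extend_path {A : Type} (Rel : A -> A -> Prop) (a b : A) : clos_trans_n1 A Rel a b ->
  forall c, chain Rel c -> end_of c = a ->
  exists c', chain Rel c' /\ extends c c' /\ (fst c < fst c')%nat /\ end_of c' = b.
Proof.
  induction 1 as [b Hb|b d Hbd Hab IH]; intros c Hc Ec.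
  - rewrite <- Ec in Hb. apply (chain_extend_step Rel); auto.
  - destruct (IH c Hc Ec) as (c1 & Hc1 & [X1 X2] & L1 & E1). rewrite <- E1 in Hbd.
    destruct (chain_extend_step Rel c1 d Hc1 Hbd) as (c2 & Hc2 & [Y1 Y2] & L2 & E2).
    exists c2. repeat split; auto; try lia.
    intros n Hn. rewrite Y2 by lia. apply X2, Hn.
Qed.

(** Stage [k + 1] extends stage [k] to an element that is [good k]. Lengths strictly increase, so
    stage [n] already fixes entry [n] and the diagonal is the limit. The good entry has index [S n]
    because it will carry data about the step that leads to it. *)
Lemma infinite_chain {A : Type} (Rel : A -> A -> Prop) (Inv : A -> Prop) (good : nat -> A -> Prop) (a0 : A) :
  Inv a0 ->
  (forall a k, Inv a -> exists b, Inv b /\ good k b /\ clos_trans_n1 A Rel a b) ->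
  exists s : nat -> A, (forall n, Rel (s n) (s (S n))) /\ forall k, exists n, good k (s (S n)).
Proof.
  intros H0 Hext.
  set (ok := fun c => chain Rel c /\ Inv (end_of c)).
  destruct (functional_choice (fun (kc : nat * (nat * (nat -> A))) c' => ok (snd kc) ->
     ok c' /\ extends (snd kc) c' /\ (fst (snd kc) < fst c')%nat /\ good (fst kc) (end_of c')))
    as [f Hf].
  { intros [k c]. destruct (classic (ok c)) as [[Hc Hi]|N]; [|exists c; contradiction].
    destruct (Hext (end_of c) k Hi) as (b & Ib & Gb & Tb).
    destruct (chain_extend_path Rel _ _ Tb c Hc eq_refl) as (c' & Hc' & X & L & E).
    exists c'. intros _. unfold ok. simpl. rewrite E. auto. }
  set (s := nat_rect (fun _ => (nat * (nat -> A))%type) (O, fun _ => a0) (fun k c => f (k, c))).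
  assert (Hok : forall k, ok (s k)).
  { induction k as [|k IH].
    - split; [intros n Hn; simpl in Hn; lia|exact H0].
    - apply (Hf (k, s k) IH). }
  assert (Hs : forall k, extends (s k) (s (S k)) /\ (fst (s k) < fst (s (S k)))%nat /\
                         good k (end_of (s (S k)))).
  { intros k. apply (Hf (k, s k) (Hok k)). }
  assert (Hmono : forall j k, extends (s k) (s (j + k)%nat)).
  { intros j k. induction j as [|j [I1 I2]]; simpl.
    - split; auto.
    - destruct (Hs (j + k)%nat) as [[X1 X2] _]. simpl in *. split; [lia|].
      intros n Hn. rewrite X2 by lia. auto. }
  assert (Hlen : forall k, (k <= fst (s k))%nat).
  { induction k as [|k IH]; [lia|]. destruct (Hs k) as (_ & L & _). lia. }
  assert (Hval : forall n k, (n <= fst (s k))%nat -> snd (s k) n = snd (s n) n).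
  { intros n k Hn. destruct (Nat.le_ge_cases n k) as [L|L].
    - destruct (Hmono (k - n)%nat n) as [_ E]. replace (k - n + n)%nat with k in E by lia.
      apply E, Hlen.
    - destruct (Hmono (n - k)%nat k) as [_ E]. replace (n - k + k)%nat with n in E by lia.
      symmetry. apply E, Hn. }
  exists (fun n => snd (s n) n). split.
  - intros n. rewrite <- (Hval n (S n)).
    + apply (Hok (S n)). generalize (Hlen (S n)). lia.
    + generalize (Hlen (S n)). lia.
  - intros k. destruct (Hs k) as (_ & L & G). exists (Nat.pred (fst (s (S k)))).
    rewrite Nat.succ_pred by lia. rewrite <- (Hval _ (S k)) by lia. exact G.
Qed.

(** * Steps inside a domain *)

Lemma open_C_iff (U : C -> Prop) :
  open U <-> forall z, U z -> exists d, 0 < d /\ forall w, Cmod (w - z) < d -> U w.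
Proof.
  split.
  - intros H z Hz. destruct (H z Hz) as [d Hd]. exists d. split; [apply cond_pos|].
    intros w Hw. apply Hd. apply C_NormedModule_mixin_compat1. exact Hw.
  - intros H z Hz. destruct (H z Hz) as [d [Hd Hw]].
    (* Balls of the product structure are squares; half-side [d / 2] suffices since
       [sqrt 2 <= 2]. *)
    assert (P : 0 < d / 2) by lra.
    exists (mkposreal _ P). intros w Hb. apply Hw.
    apply C_NormedModule_mixin_compat2 in Hb. simpl in Hb.
    assert (S2 : sqrt 2 <= 2).
    { rewrite <- (sqrt_pow2 2) at 2 by lra. apply sqrt_le_1; lra. }
    eapply Rlt_le_trans; [exact Hb|]. nra.
Qed.

(** The margin [d] will absorb the error of the series of ramps in the window of this step. *)
Definition disc_step (Om : C -> Prop) (p q : C) : Prop :=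
  exists d, 0 < d /\ forall v, Cmod (v - (p + q) / 2) <= Cmod (q - p) / 2 + d -> Om v.

Lemma disc_step_sym (Om : C -> Prop) (p q : C) : disc_step Om p q -> disc_step Om q p.
Proof.
  intros [d [Hd H]]. exists d. split; auto. intros v. rewrite (Cplus_comm q p), Cmod_minus_sym.
  rewrite (Cmod_minus_sym p q). rewrite Cmod_minus_sym. apply H.
Qed.

Lemma C2_nz : RtoC 2 <> 0.
Proof. apply RtoC_neq_0. lra. Qed.

Lemma disc_step_ball (Om : C -> Prop) (p q : C) (rho : R) :
  (forall v, Cmod (v - p) < rho -> Om v) -> Cmod (q - p) < rho / 2 -> disc_step Om p q.
Proof.
  intros H Hq. exists (rho / 4). generalize (Cmod_ge_0 (q - p)). intros P.
  split; [lra|]. intros v Hv. apply H.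
  apply Rle_lt_trans with (Cmod (v - (p + q) / 2) + Cmod ((q - p) / 2)).
  - replace (v - p)%C with ((v - (p + q) / 2) + (q - p) / 2)%C.
    + apply Cmod_triangle.
    + field.
  - rewrite Cmod_div, Cmod_R, Rabs_right by (try apply C2_nz; lra). lra.
Qed.

Lemma disc_step_l (Om : C -> Prop) (p q : C) : disc_step Om p q -> Om p.
Proof.
  intros [d [Hd H]]. apply H. replace (p - (p + q) / 2)%C with ((p - q) / 2)%C by field.
  rewrite Cmod_div, Cmod_R, Rabs_right, Cmod_minus_sym by (try apply C2_nz; lra). lra.
Qed.

(** Short steps are always possible and reversible, so both the reachable points of [Om] and the
    unreachable ones form open sets. *)
Lemma disc_step_connected (Om : C -> Prop) (p q : C) :
  open Om -> connected_set Om -> Om p -> Om q -> clos_trans_n1 C (disc_step Om) p q.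
Proof.
  intros Ho Hc Hp Hq. rewrite open_C_iff in Ho.
  set (Rc := clos_trans_n1 C (disc_step Om) p).
  (* The closure is not reflexive; the degenerate step from [p] to [p] starts it. *)
  assert (Rp : Rc p).
  { apply tn1_step. destruct (Ho p Hp) as [d [Hd H]].
    apply disc_step_ball with d; auto. replace (p - p)%C with (RtoC 0) by ring.
    rewrite Cmod_0. lra. }
  destruct (classic (Rc q)) as [|N]; auto. exfalso.
  destruct (Hc (fun z => Om z /\ Rc z) (fun z => Om z /\ ~ Rc z)) as [z (_ & [_ Z1] & [_ Z2])].
  - apply open_C_iff. intros z [Oz Rz]. destruct (Ho z Oz) as [d [Hd H]].
    exists (d / 2). split; [lra|]. intros w Hw. split; [apply H; lra|].
    eapply Relation_Operators.tn1_trans; [|exact Rz]. apply disc_step_ball with d; auto.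
  - apply open_C_iff. intros z [Oz Rz]. destruct (Ho z Oz) as [d [Hd H]].
    exists (d / 2). split; [lra|]. intros w Hw. split; [apply H; lra|].
    intros Rw. apply Rz. eapply Relation_Operators.tn1_trans; [|exact Rw].
    apply disc_step_sym, disc_step_ball with d; auto.
  - intros z Oz. destruct (classic (Rc z)); [left|right]; auto.
  - exists p. auto.
  - exists q. auto.
  - contradiction.
Qed.

(** * Series of ramps *)

Lemma term_le_sum_f_R0 (f : nat -> R) (n N : nat) :
  (forall k, 0 <= f k) -> (n <= N)%nat -> f n <= sum_f_R0 f N.
Proof.
  intros H L. induction N as [|N IH]; simpl.
  - replace n with O by lia. lra.
  - destruct (Nat.eq_dec n (S N)) as [->|NE].
    + generalize (cond_pos_sum f N H). lra.
    + generalize (IH ltac:(lia)) (H (S N)). lra.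
Qed.

(** Between [s n] and [s (S n)] only the ramp at scale [t n] is active: up to the tolerance [tau n],
    earlier ramps are finished and later ones not begun. The factor [2 ^ (k + 3)] makes the errors
    summable. The last clause places the point [x n * t n], where the derivative will be tested, in
    this window. *)
Lemma exists_scales (tau x : nat -> R) :
  (forall n, 0 < tau n) -> (forall n, 0 < x n) -> exists t s : nat -> R,
    (forall n, 2 ^ n <= s n) /\ (forall n, 2 ^ n <= t n) /\
    (forall k n rho, (k < n)%nat -> s n <= rho -> t k / rho <= tau n / 2 ^ (k + 3)) /\
    (forall k n rho, (n < k)%nat -> rho <= s (S n) -> rho / t k <= tau n / 2 ^ (k + 3)) /\
    (forall n, s n <= x n * t n <= s (S n)).
Proof.
  intros Ht Hx.
  set (f := fun n => / tau n + x n + / x n).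
  assert (P1 : forall n, 0 < / tau n) by (intros; apply Rinv_0_lt_compat, Ht).
  assert (P2 : forall n, 0 < / x n) by (intros; apply Rinv_0_lt_compat, Hx).
  assert (Pf : forall n, 0 <= f n).
  { intros n. unfold f. generalize (P1 n) (P2 n) (Hx n). lra. }
  assert (P2n : forall n, 0 < 2 ^ n) by (intros; apply pow_lt; lra).
  assert (P2n1 : forall n, 1 <= 2 ^ n) by (intros; apply pow_R1_Rle; lra).
  (* The sum runs to [S k] because the ramp [k] must meet the tolerances of all windows up to [k]
     and also of the next one; [2 +] makes the scales grow geometrically. *)
  set (M := fun k => 2 + 2 ^ (k + 4) * sum_f_R0 f (S k)).
  assert (HMf : forall k n, (n <= S k)%nat -> 2 ^ (k + 4) * f n <= M k).
  { intros k n L. unfold M. generalize (term_le_sum_f_R0 f n (S k) Pf L) (P2n (k + 4)%nat). nra. }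
  assert (HM2 : forall k, 2 <= M k).
  { intros k. unfold M. generalize (cond_pos_sum f (S k) Pf) (P2n (k + 4)%nat). nra. }
  assert (HMt : forall k n, (n <= S k)%nat -> 2 ^ (k + 4) * / tau n <= M k).
  { intros k n L. eapply Rle_trans; [|apply (HMf k n L)].
    apply Rmult_le_compat_l; [apply Rlt_le, P2n|]. unfold f. generalize (P2 n) (Hx n). lra. }
  assert (HMx : forall n, x n <= M n /\ / x n <= M n).
  { intros n. generalize (HMf n n ltac:(lia)) (P2n1 (n + 4)%nat) (P1 n) (P2 n) (Hx n) (Pf n).
    intros. assert (f n <= M n) by nra. unfold f in *. lra. }
  set (s := nat_rect (fun _ => R) 1 (fun k v => v * M k * M k) : nat -> R).
  set (t := fun k => s k * M k).
  assert (Ss : forall n, s (S n) = t n * M n) by reflexivity.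
  assert (Hs : forall n, 2 ^ n <= s n).
  { induction n as [|n IH]; [simpl; lra|]. rewrite Ss. unfold t. simpl.
    generalize (HM2 n) (P2n n). intros.
    assert (HMM : 2 * 2 <= M n * M n) by (apply Rmult_le_compat; lra).
    rewrite Rmult_assoc. apply Rle_trans with (2 ^ n * (2 * 2)); [lra|].
    apply Rmult_le_compat; lra. }
  assert (Hsp : forall n, 0 < s n) by (intros; eapply Rlt_le_trans; [apply P2n|apply Hs]).
  assert (Hst : forall n, s n <= t n) by (intros n; unfold t; rewrite <- (Rmult_1_r (s n)) at 1;
        apply Rmult_le_compat_l; [apply Rlt_le, Hsp|generalize (HM2 n); lra]).
  assert (Hts : forall n, t n <= s (S n)).
  { intros n. rewrite Ss. generalize (HM2 n) (Hst n) (Hsp n). intros.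
    rewrite <- (Rmult_1_r (t n)) at 1. apply Rmult_le_compat_l; lra. }
  assert (Hmono : forall j n, s n <= s (j + n)%nat).
  { intros j n. induction j as [|j IH]; [apply Rle_refl|].
    change (S j + n)%nat with (S (j + n)).
    eapply Rle_trans; [exact IH|]. eapply Rle_trans; [apply Hst|apply Hts]. }
  assert (Htp : forall n, 0 < t n) by (intros n; generalize (Hst n) (Hsp n); lra).
  exists t, s. repeat split.
  - exact Hs.
  - intros n. generalize (Hst n) (Hs n). lra.
  - intros k n rho L Lr. destruct n as [|n]; [lia|].
    assert (Hk : t k <= t n).
    { destruct (Nat.eq_dec k n) as [->|NE]; [lra|].
      generalize (Hts k) (Hst n) (Hmono (n - S k)%nat (S k)).
      replace (n - S k + S k)%nat with n by lia. lra. }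
    assert (HM := HMt n (S n) ltac:(lia)).
    assert (Hrho : t n * M n <= rho) by (rewrite <- Ss; exact Lr).
    generalize (Htp k) (Htp n) (HM2 n) (Ht (S n)). intros.
    assert (0 < rho) by nra.
    apply Rle_div_l; [lra|].
    apply Rle_trans with (tau (S n) / 2 ^ (k + 3) * (t n * M n)).
    2:{ apply Rmult_le_compat_l; [|lra]. apply Rlt_le, Rdiv_lt_0_compat; auto. }
    apply Rle_trans with (tau (S n) / 2 ^ (k + 3) * (t n * (2 ^ (n + 4) * / tau (S n)))).
    2:{ apply Rmult_le_compat_l; [apply Rlt_le, Rdiv_lt_0_compat; auto|].
        apply Rmult_le_compat_l; lra. }
    replace (n + 4)%nat with ((k + 3) + (n + 1 - k))%nat by lia. rewrite (pow_add 2 (k + 3)).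
    replace (tau (S n) / 2 ^ (k + 3) * (t n * (2 ^ (k + 3) * 2 ^ (n + 1 - k) * / tau (S n))))
      with (t n * 2 ^ (n + 1 - k)).
    2:{ field. split; [lra|apply Rgt_not_eq, P2n]. }
    eapply Rle_trans; [exact Hk|]. rewrite <- (Rmult_1_r (t n)) at 1.
    apply Rmult_le_compat_l; [apply Rlt_le, Htp|apply P2n1].
  - intros k n rho L Lr.
    assert (HM := HMt k n ltac:(lia)).
    assert (Hk : rho <= s k).
    { generalize (Hmono (k - S n)%nat (S n)). replace (k - S n + S n)%nat with k by lia. lra. }
    apply Rle_div_l; [apply Htp|]. unfold t.
    generalize (Ht n) (Hsp k) (P2n (k + 3)%nat). intros.
    apply Rle_trans with (tau n / 2 ^ (k + 3) * (s k * (2 ^ (k + 4) * / tau n))).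
    2:{ apply Rmult_le_compat_l; [apply Rlt_le, Rdiv_lt_0_compat; auto|].
        apply Rmult_le_compat_l; lra. }
    replace (k + 4)%nat with (S (k + 3))%nat by lia. simpl pow.
    replace (tau n / 2 ^ (k + 3) * (s k * (2 * 2 ^ (k + 3) * / tau n))) with (2 * s k)
      by (field; split; lra).
    lra.
  - unfold t. generalize (HMx n) (Hx n) (Hsp n). intros [X1 X2] X3 X4.
    assert (1 <= x n * M n).
    { apply Rmult_le_compat_l with (r := x n) in X2; [|lra]. rewrite Rinv_r in X2; lra. }
    nra.
  - rewrite Ss. generalize (HMx n) (Htp n). nra.
Qed.

(** * Series of complex numbers *)

Definition csum (a : nat -> C) (l : C) : Prop :=
  @is_series C_AbsRing C_NormedModule a l.

Lemma csum_exists (a : nat -> C) (b : nat -> R) :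
  (forall k, Cmod (a k) <= b k) -> ex_series b -> exists l, csum a l.
Proof.
  intros H Hb. apply (@ex_series_le C_AbsRing C_CompleteNormedModule a b); auto.
Qed.

Lemma csum_minus (a b : nat -> C) (l m : C) :
  csum a l -> csum b m -> csum (fun k => a k - b k)%C (l - m)%C.
Proof. apply (@is_series_minus C_AbsRing C_NormedModule). Qed.

Lemma csum_scal (c : C) (a : nat -> C) (l : C) :
  csum a l -> csum (fun k => c * a k)%C (c * l)%C.
Proof. apply (@is_series_scal C_AbsRing C_NormedModule). Qed.

Lemma csum_bound (a : nat -> C) (b : nat -> R) (l : C) (m : R) :
  csum a l -> (forall k, Cmod (a k) <= b k) -> is_series b m -> Cmod l <= m.
Proof.
  intros Ha Hab Hb.
  assert (H1 : is_lim_seq (fun n => @norm C_AbsRing C_NormedModule (@sum_n C_NormedModule a n)) (Cmod l)).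
  { apply (filterlim_comp _ _ _ (@sum_n C_NormedModule a) (@norm C_AbsRing C_NormedModule)
             eventually (@locally C_NormedModule l)); [exact Ha|].
    apply (@filterlim_norm C_AbsRing C_NormedModule). }
  assert (H2 : is_lim_seq (sum_n b) m) by exact Hb.
  apply (is_lim_seq_le _ _ _ _ ) with (2 := H1) (3 := H2).
  intros n. induction n as [|n IH].
  - rewrite !sum_O. apply Hab.
  - rewrite !sum_Sn. eapply Rle_trans; [apply (@norm_triangle C_AbsRing C_NormedModule)|].
    apply Rplus_le_compat; [exact IH|apply Hab].
Qed.

Lemma csum_finite (a : nat -> C) (n : nat) :
  (forall k, (n < k)%nat -> a k = 0) -> csum a (@sum_n C_NormedModule a n).
Proof.
  intros H. unfold csum, is_series.
  apply filterlim_ext_loc with (f := fun _ => @sum_n C_NormedModule a n).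
  - exists n. intros m Hm. induction Hm as [|m Hm IH]; auto.
    rewrite sum_Sn, <- IH, H by lia.
    symmetry. apply (@plus_zero_r C_NormedModule).
  - apply filterlim_const.
Qed.

Lemma is_series_half (c : R) : is_series (fun k => c / 2 ^ k) (2 * c).
Proof.
  replace (2 * c) with (c * / (1 - / 2)) by field.
  apply is_series_ext with (a := fun k => c * (/ 2) ^ k).
  - intros k. now rewrite pow_inv.
  - apply (@is_series_scal R_AbsRing R_NormedModule), is_series_geom.
    rewrite Rabs_right; lra.
Qed.

(** * A single ramp on the right half-plane *)

Lemma half_plane_lower (u : C) (t : R) : 0 < Re u -> 0 < t ->
  t <= Cmod (u + RtoC t) /\ Cmod u <= Cmod (u + RtoC t) /\ Cmod (u - RtoC t) <= Cmod (u + RtoC t)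
  /\ (u + RtoC t)%C <> 0.
Proof.
  intros Hu Ht.
  assert (S1 : Cmod (u + RtoC t) ^ 2 = Cmod u ^ 2 + t ^ 2 + 2 * t * Re u).
  { rewrite !Cmod2_alt. destruct u. unfold Re, Im, Cplus, RtoC. simpl. ring. }
  assert (S2 : Cmod (u - RtoC t) ^ 2 = Cmod u ^ 2 + t ^ 2 - 2 * t * Re u).
  { rewrite !Cmod2_alt. destruct u. unfold Re, Im, Cminus, Cplus, Copp, RtoC. simpl. ring. }
  assert (P := Cmod_ge_0 u). assert (P1 := Cmod_ge_0 (u + RtoC t)).
  assert (P2 := Cmod_ge_0 (u - RtoC t)).
  assert (0 < t * Re u) by (apply Rmult_lt_0_compat; auto).
  assert (L : t <= Cmod (u + RtoC t)) by nra.
  repeat split; auto; try nra. apply Cmod_gt_0. lra.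
Qed.

(** All bounds come from [|u + t|] being at least [t], [|u|] and [|u - t|]. The third says that the
    ramp stays in the disc with diameter [0, 1]; the last three concern its derivative
    [t / (u + t) ^ 2]. *)
Lemma ramp_bounds (u : C) (t : R) : 0 < Re u -> 0 < t ->
  Cmod (u / (u + RtoC t)) <= Cmod u / t /\
  Cmod (u / (u + RtoC t) - 1) <= t / Cmod u /\
  Cmod (u / (u + RtoC t) - / 2) <= / 2 /\
  Cmod (u * (RtoC t / ((u + RtoC t) * (u + RtoC t)))) <= Cmod u / t /\
  Cmod (u * (RtoC t / ((u + RtoC t) * (u + RtoC t)))) <= t / Cmod u /\
  Cmod (RtoC t / ((u + RtoC t) * (u + RtoC t))) <= / t.
Proof.
  intros Hu Ht. destruct (half_plane_lower u t Hu Ht) as (L1 & L2 & L3 & N).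
  assert (Pu : 0 < Cmod u).
  { eapply Rlt_le_trans; [exact Hu|]. eapply Rle_trans; [apply Rle_abs|apply re_le_Cmod]. }
  assert (Nt : RtoC t <> 0) by (apply RtoC_neq_0; lra).
  set (D := Cmod (u + RtoC t)) in *. assert (PD : 0 < D) by lra.
  assert (Ct : Cmod (RtoC t) = t) by (rewrite Cmod_R, Rabs_right; lra).
  assert (N2 : ((u + RtoC t) * (u + RtoC t))%C <> 0) by (apply Cmult_neq_0; auto).
  assert (Q : forall y, 0 < y -> forall e, 0 < e -> e <= D -> y / D <= y / e).
  { intros y Hy e He Le. apply Rmult_le_compat_l; [lra|]. apply Rinv_le_contravar; lra. }
  repeat split.
  - rewrite Cmod_div by auto. fold D. apply Q; auto.
  - replace (u / (u + RtoC t) - 1)%C with (- (RtoC t / (u + RtoC t)))%C by (field; auto).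
    rewrite Cmod_opp, Cmod_div, Ct by auto. fold D. apply Q; auto.
  - replace (u / (u + RtoC t) - / 2)%C with ((u - RtoC t) / (2 * (u + RtoC t)))%C.
    2:{ field. auto. }
    rewrite Cmod_div by (apply Cmult_neq_0; auto; apply C2_nz).
    rewrite Cmod_mult, Cmod_R, Rabs_right by lra. fold D.
    apply Rle_div_l; lra.
  - rewrite Cmod_mult, Cmod_div, Cmod_mult, Ct by auto. fold D.
    replace (Cmod u * (t / (D * D))) with (Cmod u * t / (D * D)) by (field; lra).
    replace (Cmod u / t) with (Cmod u * t / (t * t)) by (field; lra).
    apply Rmult_le_compat_l; [nra|]. apply Rinv_le_contravar; nra.
  - rewrite Cmod_mult, Cmod_div, Cmod_mult, Ct by auto. fold D.
    replace (Cmod u * (t / (D * D))) with (Cmod u * t / (D * D)) by (field; lra).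
    replace (t / Cmod u) with (Cmod u * t / (Cmod u * Cmod u)) by (field; lra).
    apply Rmult_le_compat_l; [nra|]. apply Rinv_le_contravar; nra.
  - rewrite Cmod_div, Cmod_mult, Ct by auto. fold D.
    replace (/ t) with (t / (t * t)) by (field; lra).
    apply Rmult_le_compat_l; [lra|]. apply Rinv_le_contravar; nra.
Qed.

(** The remainder is exactly [- t * (w - u) ^ 2 / ((w + t) * (u + t) ^ 2)]. *)
Lemma ramp_second_order (u w : C) (t : R) : 0 < Re u -> 0 < Re w -> 0 < t ->
  Cmod (w / (w + RtoC t) - u / (u + RtoC t)
        - RtoC t / ((u + RtoC t) * (u + RtoC t)) * (w - u)) <= Cmod (w - u) ^ 2 / t ^ 2.
Proof.
  intros Hu Hw Ht. destruct (half_plane_lower u t Hu Ht) as (L1 & _ & _ & N1).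
  destruct (half_plane_lower w t Hw Ht) as (L2 & _ & _ & N2).
  replace (w / (w + RtoC t) - u / (u + RtoC t)
        - RtoC t / ((u + RtoC t) * (u + RtoC t)) * (w - u))%C
    with (- (RtoC t * ((w - u) * (w - u)) / ((w + RtoC t) * ((u + RtoC t) * (u + RtoC t)))))%C
    by (field; auto).
  rewrite Cmod_opp, Cmod_div by (repeat apply Cmult_neq_0; auto).
  rewrite !Cmod_mult, Cmod_R, Rabs_right by lra.
  generalize (Cmod_ge_0 (w - u)). intros P.
  replace (Cmod (w - u) ^ 2 / t ^ 2) with (t * (Cmod (w - u) * Cmod (w - u)) / (t * (t * t)))
    by (field; lra).
  apply Rmult_le_compat_l; [apply Rmult_le_pos; nra|].
  apply Rinv_le_contravar; [repeat apply Rmult_lt_0_compat; lra|].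
  apply Rmult_le_compat; try nra.
Qed.

Definition ramp_series (d : nat -> C) (t : nat -> R) (u l : C) : Prop :=
  csum (fun k => d k * (u / (u + RtoC (t k))))%C l.

Definition ramp_deriv_series (d : nat -> C) (t : nat -> R) (u l : C) : Prop :=
  csum (fun k => d k * (RtoC (t k) / ((u + RtoC (t k)) * (u + RtoC (t k)))))%C l.

Lemma ramp_series_exist (d : nat -> C) (t : nat -> R) :
  (forall k, Cmod (d k) <= 2) -> (forall k, 2 ^ k <= t k) ->
  exists F G : C -> C, forall u, 0 < Re u ->
    ramp_series d t u (F u) /\ ramp_deriv_series d t u (G u).
Proof.
  intros Hd Ht.
  assert (P2n : forall n, 0 < 2 ^ n) by (intros; apply pow_lt; lra).
  assert (Hi : forall k, / t k <= / 2 ^ k) by (intros; apply Rinv_le_contravar; auto).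
  assert (Htp : forall k, 0 < t k) by (intros k; generalize (P2n k) (Ht k); lra).
  (* Outside the half-plane the sum gets the default value 0. *)
  destruct (functional_choice (fun u l => 0 < Re u -> ramp_series d t u l)) as [F HF].
  { intros u. destruct (Rlt_le_dec 0 (Re u)) as [Hu|Hu]; [|exists (RtoC 0); lra].
    destruct (csum_exists (fun k => d k * (u / (u + RtoC (t k))))%C (fun k => 2 * Cmod u / 2 ^ k))
      as [l Hl].
    - intros k. destruct (ramp_bounds u (t k) Hu (Htp k)) as (B & _).
      rewrite Cmod_mult. replace (2 * Cmod u / 2 ^ k) with (2 * (Cmod u * / 2 ^ k)) by (unfold Rdiv; ring).
      apply Rmult_le_compat; auto; try apply Cmod_ge_0.
      eapply Rle_trans; [exact B|]. apply Rmult_le_compat_l; [apply Cmod_ge_0|auto].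
    - eexists. apply is_series_half.
    - exists l. auto. }
  destruct (functional_choice (fun u l => 0 < Re u -> ramp_deriv_series d t u l)) as [G HG].
  { intros u. destruct (Rlt_le_dec 0 (Re u)) as [Hu|Hu]; [|exists (RtoC 0); lra].
    destruct (csum_exists (fun k => d k * (RtoC (t k) / ((u + RtoC (t k)) * (u + RtoC (t k)))))%C
                (fun k => 2 / 2 ^ k)) as [l Hl].
    - intros k. destruct (ramp_bounds u (t k) Hu (Htp k)) as (_ & _ & _ & _ & _ & B).
      rewrite Cmod_mult. apply Rmult_le_compat; auto; try apply Cmod_ge_0.
      eapply Rle_trans; [exact B|auto].
    - eexists. apply is_series_half.
    - exists l. auto. }
  exists F, G. auto.
Qed.

Lemma ramp_series_cderiv (d : nat -> C) (t : nat -> R) (F G : C -> C) :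
  (forall k, Cmod (d k) <= 2) -> (forall k, 2 ^ k <= t k) ->
  (forall u, 0 < Re u -> ramp_series d t u (F u) /\ ramp_deriv_series d t u (G u)) ->
  forall u, 0 < Re u -> cderiv F u (G u).
Proof.
  (* The radius keeps [w] in the half-plane. The termwise remainders are summed directly: 4 is the
     bound 2 on the coefficients times the geometric sum 2. *)
  intros Hd Ht H u Hu. apply cderiv_quadratic with (d := Re u) (M := 4); auto.
  intros w Hw.
  assert (Hrw : 0 < Re w).
  { generalize (re_le_Cmod (w - u)) (Rle_abs (- Re (w - u))). rewrite Rabs_Ropp.
    unfold Cminus. rewrite re_plus, re_opp. fold (Cminus w u). lra. }
  assert (P2n : forall n, 1 <= 2 ^ n) by (intros; apply pow_R1_Rle; lra).
  assert (Sd := csum_minus _ _ _ _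
     (csum_minus _ _ _ _ (proj1 (H w Hrw)) (proj1 (H u Hu)))
     (csum_scal (w - u)%C _ _ (proj2 (H u Hu)))).
  replace (G u * (w - u))%C with ((w - u) * G u)%C by ring.
  replace (4 * Cmod (w - u) ^ 2) with (2 * (2 * Cmod (w - u) ^ 2)) by ring.
  apply (csum_bound _ (fun k => 2 * Cmod (w - u) ^ 2 / 2 ^ k) _ _ Sd); [|apply is_series_half].
  intros k. cbv beta.
  match goal with |- Cmod ?e <= _ => replace e with
    (d k * (w / (w + RtoC (t k)) - u / (u + RtoC (t k))
        - RtoC (t k) / ((u + RtoC (t k)) * (u + RtoC (t k))) * (w - u)))%C by (unfold Cdiv; ring) end.
  assert (Htk : 1 <= t k) by (generalize (P2n k) (Ht k); lra).
  rewrite Cmod_mult.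
  replace (2 * Cmod (w - u) ^ 2 / 2 ^ k) with (2 * (Cmod (w - u) ^ 2 * / 2 ^ k)) by (unfold Rdiv; ring).
  apply Rmult_le_compat; auto; try apply Cmod_ge_0.
  eapply Rle_trans; [apply ramp_second_order; auto; lra|].
  apply Rmult_le_compat_l; [apply pow2_ge_0|].
  apply Rinv_le_contravar; [generalize (P2n k); lra|]. generalize (P2n k) (Ht k). nra.
Qed.

(** Window 0 has no lower end, since no ramp precedes it; this lets the windows cover everything. *)
Definition in_window (s : nat -> R) (n : nat) (u : C) : Prop :=
  (n = O \/ s n <= Cmod u) /\ Cmod u <= s (S n).

Lemma window_cover (s : nat -> R) (u : C) :
  (forall n, 2 ^ n <= s n) -> exists n, in_window s n u.
Proof.
  intros Hs.
  assert (HN : exists N, Cmod u <= s (S N)).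
  { destruct (Pow_x_infinity 2) with (b := Cmod u) as [N HN].
    - rewrite Rabs_right; lra.
    - exists N. specialize (HN (S N) ltac:(lia)).
      rewrite Rabs_right in HN by (apply Rle_ge, pow_le; lra). generalize (Hs (S N)). lra. }
  destruct HN as [N HN]. induction N as [|N IH].
  - exists O. split; auto.
  - destruct (Rle_lt_dec (Cmod u) (s (S N))) as [L|L]; auto.
    exists (S N). split; [right; lra|auto].
Qed.

(* In the [n]-th window all the ramps before the [n]-th have essentially reached [1] and all
   the later ones have not yet left [0]. *)
Lemma ramp_series_window (p : nat -> C) (t s tau : nat -> R) (F G : C -> C) (n : nat) (u : C) :
  (forall k, Cmod (p (S k) - p k) <= 2) -> (forall k, 2 ^ k <= t k) -> 0 < tau n ->
  (forall k n rho, (k < n)%nat -> s n <= rho -> t k / rho <= tau n / 2 ^ (k + 3)) ->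
  (forall k n rho, (n < k)%nat -> rho <= s (S n) -> rho / t k <= tau n / 2 ^ (k + 3)) ->
  (forall u, 0 < Re u -> ramp_series (fun k => p (S k) - p k)%C t u (F u) /\
                         ramp_deriv_series (fun k => p (S k) - p k)%C t u (G u)) ->
  0 < Re u -> in_window s n u ->
  Cmod (p O + F u - (p n + (p (S n) - p n) * (u / (u + RtoC (t n))))) <= tau n / 2 /\
  Cmod (u * (G u - (p (S n) - p n) * (RtoC (t n) / ((u + RtoC (t n)) * (u + RtoC (t n))))))
    <= tau n / 2.
Proof.
  intros Hd Ht Htau Hlo Hhi HFG Hu [W1 W2].
  set (d := fun k => (p (S k) - p k)%C) in *.
  assert (Hdk : forall k, Cmod (d k) <= 2) by exact Hd.
  assert (P2n : forall n, 0 < 2 ^ n) by (intros; apply pow_lt; lra).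
  assert (Htp : forall k, 0 < t k) by (intros k; generalize (P2n k) (Ht k); lra).
  (* The bound 2 on the coefficients turns [tau n / 2 ^ (k + 3)] into these terms. *)
  assert (Hgeo : is_series (fun k => tau n / 4 / 2 ^ k) (tau n / 2)).
  { replace (tau n / 2) with (2 * (tau n / 4)) by field. apply is_series_half. }
  assert (Hterm : forall k y, y <= tau n / 2 ^ (k + 3) -> 2 * y <= tau n / 4 / 2 ^ k).
  { intros k y Hy. replace (tau n / 4 / 2 ^ k) with (2 * (tau n / 2 ^ (k + 3))); [lra|].
    rewrite pow_add. field. apply Rgt_not_eq, P2n. }
  assert (Hpos : forall k, 0 <= tau n / 4 / 2 ^ k).
  { intros k. apply Rlt_le, Rdiv_lt_0_compat; auto. lra. }
  destruct (HFG u Hu) as [HF HG].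
  split.
  (* The comparison series has full steps before [n], the true ramp at [n] and zeros after; its sum
     telescopes. *)
  - set (c := fun k => match Nat.compare k n with
        | Lt => d k | Eq => (d k * (u / (u + RtoC (t k))))%C | Gt => RtoC 0 end).
    assert (Ec : forall m, (m < n)%nat -> @sum_n C_NormedModule c m = (p (S m) - p O)%C).
    { induction m as [|m IH]; intros L.
      - rewrite sum_O. unfold c. rewrite (proj2 (Nat.compare_lt_iff _ _) L). reflexivity.
      - rewrite sum_Sn, IH by lia. unfold c. rewrite (proj2 (Nat.compare_lt_iff _ _) L).
        unfold d. change (p (S m) - p O + (p (S (S m)) - p (S m)) = p (S (S m)) - p O)%C. ring. }
    assert (Ec' : @sum_n C_NormedModule c n = (p n - p O + d n * (u / (u + RtoC (t n))))%C).
    { destruct n as [|m].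
      - rewrite sum_O. unfold c. simpl. ring.
      - rewrite sum_Sn, Ec by lia. unfold c. rewrite Nat.compare_refl. reflexivity. }
    assert (Sc : csum c (@sum_n C_NormedModule c n)).
    { apply csum_finite. intros k L. unfold c. now rewrite (proj2 (Nat.compare_gt_iff _ _) L). }
    rewrite Ec' in Sc.
    assert (Sd := csum_minus _ _ _ _ HF Sc).
    replace (p O + F u - (p n + (p (S n) - p n) * (u / (u + RtoC (t n)))))%C
      with (F u - (p n - p O + d n * (u / (u + RtoC (t n)))))%C by (unfold d; ring).
    apply (csum_bound _ _ _ _ Sd) with (2 := Hgeo).
    intros k. cbv beta. unfold c.
    destruct (ramp_bounds u (t k) Hu (Htp k)) as (B1 & B2 & _).
    destruct (Nat.compare_spec k n) as [E|L|L].
    + match goal with |- Cmod ?e <= _ => replace e with (RtoC 0) by ring end.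
      rewrite Cmod_0. auto.
    + match goal with |- Cmod ?e <= _ => replace e with (d k * (u / (u + RtoC (t k)) - 1))%C by ring end.
      rewrite Cmod_mult. apply Rle_trans with (2 * (t k / Cmod u)).
      * apply Rmult_le_compat; auto; apply Cmod_ge_0.
      * apply Hterm, Hlo; auto. destruct W1; [lia|auto].
    + match goal with |- Cmod ?e <= _ => replace e with (d k * (u / (u + RtoC (t k))))%C by ring end.
      rewrite Cmod_mult. apply Rle_trans with (2 * (Cmod u / t k)).
      * apply Rmult_le_compat; auto; apply Cmod_ge_0.
      * apply Hterm, Hhi; auto.
  (* For derivatives only the [n]-th term is compared. The factor [u] makes the others small on both
     sides of the window. *)
  - set (g := fun k => (d k * (RtoC (t k) / ((u + RtoC (t k)) * (u + RtoC (t k)))))%C).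
    set (c := fun k => if Nat.eqb k n then g k else RtoC 0).
    assert (Ec : forall m, (m < n)%nat -> @sum_n C_NormedModule c m = RtoC 0).
    { induction m as [|m IH]; intros L.
      - rewrite sum_O. unfold c. rewrite (proj2 (Nat.eqb_neq _ _)); [reflexivity|lia].
      - rewrite sum_Sn, IH by lia. unfold c. rewrite (proj2 (Nat.eqb_neq _ _)) by lia.
        change (0 + 0 = RtoC 0)%C. ring. }
    assert (Ec' : @sum_n C_NormedModule c n = g n).
    { destruct n as [|m].
      - rewrite sum_O. reflexivity.
      - rewrite sum_Sn, Ec by lia. unfold c. rewrite Nat.eqb_refl.
        change (0 + g (S m) = g (S m))%C. ring. }
    assert (Sc : csum c (@sum_n C_NormedModule c n)).
    { apply csum_finite. intros k L. unfold c. rewrite (proj2 (Nat.eqb_neq _ _)); [reflexivity|lia]. }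
    rewrite Ec' in Sc.
    assert (Sd := csum_scal u _ _ (csum_minus _ _ _ _ HG Sc)).
    change (Cmod (u * (G u - g n)) <= tau n / 2).
    apply (csum_bound _ _ _ _ Sd) with (2 := Hgeo).
    intros k. cbv beta. unfold c.
    destruct (ramp_bounds u (t k) Hu (Htp k)) as (_ & _ & _ & B1 & B2 & _).
    destruct (Nat.eqb_spec k n) as [E|NE].
    + match goal with |- Cmod ?e <= _ => replace e with (RtoC 0) by (unfold g; ring) end.
      rewrite Cmod_0. auto.
    + match goal with |- Cmod ?e <= _ => replace e with
        (d k * (u * (RtoC (t k) / ((u + RtoC (t k)) * (u + RtoC (t k))))))%C by ring end.
      rewrite Cmod_mult. destruct (Nat.lt_total k n) as [L|[L|L]]; [|contradiction|].
      * apply Rle_trans with (2 * (t k / Cmod u)).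
        -- apply Rmult_le_compat; auto; apply Cmod_ge_0.
        -- apply Hterm, Hlo; auto. destruct W1; [lia|auto].
      * apply Rle_trans with (2 * (Cmod u / t k)).
        -- apply Rmult_le_compat; auto; apply Cmod_ge_0.
        -- apply Hterm, Hhi; auto.
Qed.

(** * Large hyperbolic discs *)

(* The hyperbolic derivative, at the point [x t] of the right half-plane, of the conformal map
   [u |-> p + (q - p) u / (u + t)] onto the disc with diameter [[p, q]]. *)
Definition step_ratio (p q : C) (x : R) : R :=
  2 * x / (1 + x) ^ 2 * Cmod (q - p) / (1 - Cmod (p + (q - p) * RtoC (x / (1 + x))) ^ 2).

Lemma polar_decomposition (a : C) : exists e, Cmod e = 1 /\ a = (RtoC (Cmod a) * e)%C.
Proof.
  destruct (Ceq_dec a 0) as [->|N].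
  - exists (RtoC 1). rewrite Cmod_1, Cmod_0. split; [auto|ring].
  - assert (P := proj1 (Cmod_gt_0 a) N).
    assert (NM : RtoC (Cmod a) <> 0) by (apply RtoC_neq_0; lra).
    exists (a / RtoC (Cmod a))%C. split.
    + rewrite Cmod_div, Cmod_R, Rabs_right by (auto; lra). field. lra.
    + field. auto.
Qed.

(** These are the Euclidean centre and radius of the pseudo-hyperbolic disc of radius [r] about [a]:
    the difference of the squared sides of the conclusion is [k] times that of the hypothesis. *)
Lemma hyp_disc_euclidean (a v : C) (r : R) : in_disc a -> 0 < r < 1 ->
  Cmod (v - a * RtoC ((1 - r ^ 2) / (1 - r ^ 2 * Cmod a ^ 2)))
    <= r * (1 - Cmod a ^ 2) / (1 - r ^ 2 * Cmod a ^ 2) ->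
  Cmod (v - a) <= r * Cmod (1 - Cconj a * v).
Proof.
  intros Da Hr H. assert (S := in_disc_sqr a Da). assert (P := pow2_ge_0 (Cmod a)).
  set (al := Cmod a) in *. set (k := 1 - r ^ 2 * al ^ 2) in *.
  assert (Hk : 0 < k) by (unfold k; nra).
  set (A := r * (1 - al ^ 2) / k) in *. set (c := (1 - r ^ 2) / k) in *.
  assert (HA : 0 <= A) by (unfold A; apply Rlt_le, Rdiv_lt_0_compat; nra).
  assert (H2 : Cmod (v - a * RtoC c) ^ 2 <= A ^ 2).
  { apply pow_incr. split; [apply Cmod_ge_0|auto]. }
  assert (E : Cmod (v - a) ^ 2 - r ^ 2 * Cmod (1 - Cconj a * v) ^ 2
              = k * (Cmod (v - a * RtoC c) ^ 2 - A ^ 2)).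
  { assert (Ek : k <> 0) by lra.
    assert (E1 : Cmod (v - a * RtoC c) ^ 2 = Cmod v ^ 2 + c ^ 2 * al ^ 2 - 2 * c * Re (v * Cconj a)).
    { unfold al. rewrite !Cmod2_alt. destruct v, a.
      unfold Re, Im, Cminus, Cplus, Copp, Cmult, Cconj, RtoC. simpl. ring. }
    assert (E2 : Cmod (v - a) ^ 2 = Cmod v ^ 2 + al ^ 2 - 2 * Re (v * Cconj a)).
    { unfold al. rewrite !Cmod2_alt. destruct v, a.
      unfold Re, Im, Cminus, Cplus, Copp, Cmult, Cconj, RtoC. simpl. ring. }
    assert (E3 : Cmod (1 - Cconj a * v) ^ 2 = 1 + al ^ 2 * Cmod v ^ 2 - 2 * Re (v * Cconj a)).
    { unfold al. rewrite !Cmod2_alt. destruct v, a.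
      unfold Re, Im, Cminus, Cplus, Copp, Cmult, Cconj, RtoC. simpl. ring. }
    rewrite E1, E2, E3. unfold A, c, k in *. field. rewrite Rpow_mult_distr. exact Ek. }
  assert (H3 : Cmod (v - a) ^ 2 <= (r * Cmod (1 - Cconj a * v)) ^ 2) by nra.
  assert (Q1 := Cmod_ge_0 (v - a)).
  assert (Q2 : 0 <= r * Cmod (1 - Cconj a * v)) by (apply Rmult_le_pos; [lra|apply Cmod_ge_0]).
  nra.
Qed.

(** Provides the margin of a disc step: moving by [d] changes both sides by at most [d], while
    [|1 - conj a * v'|] is at least [1 - |a|]. *)
Lemma pseudo_hyp_slack (a v v' : C) (r r' d : R) :
  in_disc a -> Cmod v' <= 1 -> 0 <= r < r' -> r' < 1 ->
  Cmod (v' - a) <= r * Cmod (1 - Cconj a * v') ->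
  Cmod (v - v') <= d -> 2 * d < (r' - r) * (1 - Cmod a) ->
  in_disc v /\ pseudo_hyp v a < r'.
Proof.
  intros Da Dv' Hr Hr' H Hd Hd2.
  assert (A1 := Cmod_ge_0 a). unfold in_disc in Da.
  assert (L0 : 1 - Cmod a <= Cmod (1 - Cconj a * v')).
  { generalize (Cmod_triangle_rev 1 (Cconj a * v')).
    rewrite Cmod_1, Cmod_mult, Cmod_conj. generalize (Cmod_ge_0 v'). nra. }
  assert (L1 : Cmod (v - a) <= d + Cmod (v' - a)).
  { generalize (Cmod_minus_triangle v v' a). lra. }
  assert (L2 : Cmod (1 - Cconj a * v') - d <= Cmod (1 - Cconj a * v)).
  { generalize (Cmod_triangle_rev (1 - Cconj a * v') (Cconj a * (v - v'))).
    replace (1 - Cconj a * v' - Cconj a * (v - v'))%C with (1 - Cconj a * v)%C by ring.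
    rewrite Cmod_mult, Cmod_conj. generalize (Cmod_ge_0 (v - v')). nra. }
  assert (Hd0 : 0 <= d) by (generalize (Cmod_ge_0 (v - v')); lra).
  assert (L3 : Cmod (v - a) < r' * Cmod (1 - Cconj a * v)) by nra.
  assert (PD : 0 < Cmod (1 - Cconj a * v)).
  { generalize (Cmod_ge_0 (v - a)). nra. }
  split.
  - assert (E := disc_identity a v). unfold in_disc.
    assert (Sa := in_disc_sqr a Da).
    assert (L4 : Cmod (v - a) < Cmod (1 - Cconj a * v)) by nra.
    assert (L5 : 0 < (1 - Cmod v ^ 2) * (1 - Cmod a ^ 2)).
    { rewrite <- E. generalize (Cmod_ge_0 (v - a)). nra. }
    assert (L6 : 0 < 1 - Cmod v ^ 2).
    { apply Rmult_lt_reg_r with (1 - Cmod a ^ 2); lra. }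
    generalize (Cmod_ge_0 v). nra.
  - unfold pseudo_hyp. rewrite Cmod_div by (apply Cmod_gt_0; auto).
    apply Rlt_div_l; auto.
Qed.

Lemma nearest_in_disc (c v : C) (A d : R) : 0 <= A -> 0 <= d -> Cmod (v - c) <= A + d ->
  exists v', Cmod (v' - c) <= A /\ Cmod (v - v') <= d.
Proof.
  intros HA Hd H. destruct (Rle_lt_dec (Cmod (v - c)) A) as [L|L].
  - exists v. split; auto. replace (v - v)%C with (RtoC 0) by ring. rewrite Cmod_0. auto.
  - set (m := Cmod (v - c)) in *. assert (Hm : 0 < m) by lra.
    assert (Nm : RtoC m <> 0) by (apply RtoC_neq_0; lra).
    exists (c + RtoC (A / m) * (v - c))%C. split.
    + replace (c + RtoC (A / m) * (v - c) - c)%C with (RtoC (A / m) * (v - c))%C by ring.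
      rewrite Cmod_mult, Cmod_R, Rabs_right.
      * fold m. right. field. lra.
      * apply Rle_ge, Rmult_le_pos; auto. apply Rlt_le, Rinv_0_lt_compat, Hm.
    + replace (v - (c + RtoC (A / m) * (v - c)))%C with (RtoC (1 - A / m) * (v - c))%C.
      2:{ rewrite RtoC_minus. ring. }
      assert (A / m < 1) by (apply Rlt_div_l; lra).
      rewrite Cmod_mult, Cmod_R, Rabs_right by lra. fold m.
      replace ((1 - A / m) * m) with (m - A) by (field; lra). lra.
Qed.

(** The step runs along the diameter, on a line through 0 and [a], of the pseudo-hyperbolic disc of
    radius [r] about [a]. Up to automorphisms, the conformal map onto this disc is multiplication by
    [r], so its hyperbolic derivative at the preimage of [a] is exactly [r]. *)
Lemma large_disc_step (Om : C -> Prop) (a : C) (R0 r : R) :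
  in_disc a -> 0 < r < 1 -> r ^ 2 < (exp (2 * R0) - 1) / (exp (2 * R0) + 1) ->
  (forall w, hyp_disc a R0 w -> Om w) ->
  exists p q x, disc_step Om p q /\ 0 < x /\ step_ratio p q x = r.
Proof.
  intros Da Hr HT Hsub.
  set (T := (exp (2 * R0) - 1) / (exp (2 * R0) + 1)) in *.
  assert (HT1 : T < 1).
  { unfold T. assert (PE := exp_pos (2 * R0)). apply Rlt_div_l; lra. }
  assert (P2 := pow2_ge_0 r).
  set (r' := sqrt T).
  assert (Er' : r' ^ 2 = T) by (unfold r'; apply pow2_sqrt; lra).
  assert (Hr'0 : 0 <= r') by apply sqrt_pos.
  assert (Hr' : r < r' < 1) by (split; nra).
  destruct (polar_decomposition a) as [e [He Ea]].
  set (al := Cmod a) in *. assert (Hal : 0 <= al < 1) by (split; [apply Cmod_ge_0|exact Da]).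
  set (k := 1 - r ^ 2 * al ^ 2).
  assert (Hr2 : r ^ 2 < 1) by lra. assert (Hal2 : 0 <= al ^ 2 < 1) by nra.
  assert (Hk : 0 < k) by (unfold k; nra).
  set (c := (a * RtoC ((1 - r ^ 2) / k))%C). set (A := r * (1 - al ^ 2) / k).
  assert (HA : 0 < A).
  { unfold A. apply Rdiv_lt_0_compat; auto. apply Rmult_lt_0_compat; lra. }
  (* Solves [x / (1 + x) = (1 + al * r) / 2], the relative position of [a] on the diameter. *)
  set (x := (1 + al * r) / (1 - al * r)).
  assert (Har : 0 <= al * r < 1) by nra.
  assert (Hx : 0 < x) by (unfold x; apply Rdiv_lt_0_compat; lra).
  exists (c - RtoC A * e)%C, (c + RtoC A * e)%C, x.
  assert (Ed : (c + RtoC A * e - (c - RtoC A * e))%C = (RtoC (2 * A) * e)%C).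
  { rewrite RtoC_mult. ring. }
  assert (Em : ((c - RtoC A * e + (c + RtoC A * e)) / 2)%C = c) by field.
  assert (Cd : Cmod (RtoC (2 * A) * e) = 2 * A).
  { rewrite Cmod_mult, He, Cmod_R, Rabs_right; lra. }
  split; [|split; auto].
  - set (d := (r' - r) * (1 - al) / 4).
    assert (Hd : 0 < d) by (unfold d; apply Rdiv_lt_0_compat; [apply Rmult_lt_0_compat; lra|lra]).
    exists d. split; auto. intros v. rewrite Em, Ed, Cd. intros Hv.
    destruct (nearest_in_disc c v A d) as [v' [Hv'1 Hv'2]]; try lra.
    assert (H1 : Cmod (v' - a) <= r * Cmod (1 - Cconj a * v')).
    { apply hyp_disc_euclidean; auto. }
    assert (Dv' : Cmod v' <= 1).
    { assert (Ec : Cmod c = al * ((1 - r ^ 2) / k)).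
      { unfold c. rewrite Cmod_mult, Cmod_R, Rabs_right; [reflexivity|].
        apply Rle_ge, Rlt_le, Rdiv_lt_0_compat; nra. }
      assert (LcA : Cmod c + A <= 1).
      { rewrite Ec. unfold A.
        replace (al * ((1 - r ^ 2) / k) + r * (1 - al ^ 2) / k)
          with ((al * (1 - r ^ 2) + r * (1 - al ^ 2)) / k) by (field; lra).
        apply Rle_div_l; [lra|]. unfold k.
        assert (0 <= (1 - al) * (1 - r) * (1 - al * r)) by (repeat apply Rmult_le_pos; lra).
        nra. }
      generalize (Cmod_triangle (v' - c) c). replace (v' - c + c)%C with v' by ring. lra. }
    destruct (pseudo_hyp_slack a v v' r r' d) as [Dv Lv]; auto; try lra.
    { fold al. unfold d. nra. }
    apply Hsub. split; auto. apply d_h_lt_iff; auto. fold T. rewrite <- Er'.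
    assert (0 <= pseudo_hyp v a) by apply Cmod_ge_0. nra.
  - unfold step_ratio. rewrite Ed, Cd.
    assert (Ex : x / (1 + x) = (1 + al * r) / 2) by (unfold x; field; lra).
    assert (Ev : (c - RtoC A * e + RtoC (2 * A) * e * RtoC (x / (1 + x)))%C = a).
    { transitivity (RtoC (al * ((1 - r ^ 2) / k) - A + 2 * A * (x / (1 + x))) * e)%C.
      - unfold c. rewrite Ea at 1.
        rewrite RtoC_plus, RtoC_minus, !RtoC_mult. ring.
      - rewrite Ea at 1. f_equal. f_equal. rewrite Ex. unfold A. unfold k in *. field. lra. }
    rewrite Ev. fold al.
    assert (E2 : 2 * x / (1 + x) ^ 2 = k / 2).
    { unfold x, k. field. lra. }
    rewrite E2. unfold A. field. split; nra.
Qed.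

(** * A map with hyperbolic derivative close to one *)

Definition cayley (z : C) : C := ((1 + z) / (1 - z))%C.

Lemma one_minus_nz (z : C) : in_disc z -> (1 - z)%C <> 0.
Proof.
  intros Dz. apply Cmod_gt_0. generalize (Cmod_triangle_rev 1 z). rewrite Cmod_1.
  unfold in_disc in Dz. lra.
Qed.

Lemma Re_cayley (z : C) : in_disc z -> 0 < Re (cayley z).
Proof.
  intros Dz. assert (N := one_minus_nz z Dz). assert (P := proj1 (Cmod_gt_0 _) N).
  assert (E : (cayley z * RtoC (Cmod (1 - z) ^ 2))%C = ((1 + z) * Cconj (1 - z))%C).
  { rewrite Cmod2_conj. unfold cayley. field. auto. }
  assert (E2 : Re (cayley z) * Cmod (1 - z) ^ 2 = 1 - Cmod z ^ 2).
  { rewrite <- re_scal_r, E, Cmod2_alt. destruct z.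
    unfold Re, Im, Cminus, Cplus, Copp, Cmult, Cconj, RtoC. simpl. ring. }
  assert (S := in_disc_sqr z Dz).
  apply Rmult_lt_reg_r with (Cmod (1 - z) ^ 2); [apply pow_lt; auto|]. lra.
Qed.

Lemma cderiv_cayley (z : C) : in_disc z -> cderiv cayley z (2 / ((1 - z) * (1 - z)))%C.
Proof.
  intros Dz. assert (N := one_minus_nz z Dz).
  replace (2 / ((1 - z) * (1 - z)))%C
    with (((0 + 1) * (1 - z) - (1 + z) * (0 - 1)) / ((1 - z) * (1 - z)))%C by (field; auto).
  apply (cderiv_div (fun z => 1 + z)%C (fun z => 1 - z)%C); auto.
  - apply cderiv_plus; [apply cderiv_const|apply cderiv_id].
  - apply cderiv_minus; [apply cderiv_const|apply cderiv_id].
Qed.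

(* The label [(x, eta)] of a state [(q, (x, eta))] describes the step that leads to [q]; steps
   that only serve to connect large discs carry the void label [(1, 2)]. *)
Definition labelled_step (Om : C -> Prop) (st st' : C * (R * R)) : Prop :=
  disc_step Om (fst st) (fst st') /\ 0 < fst (snd st') /\ 0 < snd (snd st') /\
  1 - snd (snd st') < step_ratio (fst st) (fst st') (fst (snd st')).

Lemma segment_in_step (p q : C) (x : R) : 0 <= x ->
  Cmod (p + (q - p) * RtoC (x / (1 + x)) - (p + q) / 2) <= Cmod (q - p) / 2.
Proof.
  intros Hx. replace (p + (q - p) * RtoC (x / (1 + x)) - (p + q) / 2)%C
    with ((q - p) * RtoC (x / (1 + x) - / 2))%C.
  2:{ rewrite RtoC_minus, RtoC_inv by lra. field. }
  rewrite Cmod_mult, Cmod_R. generalize (Cmod_ge_0 (q - p)). intros P.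
  assert (Rabs (x / (1 + x) - / 2) <= / 2); [|nra].
  assert (0 <= x / (1 + x) <= 1).
  { split; [apply Rmult_le_pos; [auto|apply Rlt_le, Rinv_0_lt_compat; lra]|apply Rle_div_l; lra]. }
  apply Rabs_le. lra.
Qed.

Lemma disc_step_inside (Om : C -> Prop) (p q : C) (x : R) : (forall z, Om z -> in_disc z) ->
  disc_step Om p q -> 0 <= x -> in_disc (p + (q - p) * RtoC (x / (1 + x)))%C.
Proof.
  intros HD [d [Hd H]] Hx. apply HD, H. generalize (segment_in_step p q x Hx). lra.
Qed.

(** The label [(1, 2)] demands only that [step_ratio] exceed -1, and it is nonnegative inside the
    disc. *)
Lemma labelled_path (Om : C -> Prop) (p q : C) (lab : R * R) : (forall z, Om z -> in_disc z) ->
  clos_trans_n1 C (disc_step Om) p q ->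
  clos_trans_n1 (C * (R * R)) (labelled_step Om) (p, lab) (q, (1, 2)).
Proof.
  intros HD H.
  assert (Hlab : forall a b l, disc_step Om a b -> labelled_step Om (a, l) (b, (1, 2))).
  { intros a b l Hab. repeat split; simpl; auto; try lra.
    assert (Da := disc_step_inside Om a b 1 HD Hab ltac:(lra)). apply in_disc_sqr in Da.
    unfold step_ratio.
    apply Rlt_le_trans with 0; [lra|].
    apply Rmult_le_pos; [|apply Rlt_le, Rinv_0_lt_compat, Da].
    apply Rmult_le_pos; [lra|apply Cmod_ge_0]. }
  induction H as [q Hq|q r Hqr Hpq IH].
  - apply tn1_step. auto.
  - eapply Relation_Operators.tn1_trans; [|exact IH]. auto.
Qed.

Lemma tanh_radius (y : R) : 0 < y < 1 -> exists R0, 0 < R0 /\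
  (exp (2 * R0) - 1) / (exp (2 * R0) + 1) = y.
Proof.
  intros Hy. set (E := (1 + y) / (1 - y)).
  assert (HE : 1 < E) by (unfold E; apply Rlt_div_r; lra).
  exists (ln E / 2). split.
  - assert (0 < ln E) by (rewrite <- ln_1; apply ln_increasing; lra). lra.
  - replace (2 * (ln E / 2)) with (ln E) by field. rewrite exp_ln by lra. unfold E. field. lra.
Qed.

Lemma large_discs_chain (Om : C -> Prop) : subdomain_of_disc Om ->
  (forall R0, 0 < R0 -> exists a, in_disc a /\ forall w, hyp_disc a R0 w -> Om w) ->
  exists st : nat -> C * (R * R), (forall n, labelled_step Om (st n) (st (S n))) /\
    forall k, exists n, snd (snd (st (S n))) = / INR (S k).
Proof.
  intros ([z0 Hz0] & Ho & Hc & HD) Hbig.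
  apply (infinite_chain (labelled_step Om) (fun st => Om (fst st))
           (fun k st => snd (snd st) = / INR (S k)) (z0, (1, 2))); auto.
  intros [p lab] k Hp. simpl in Hp.
  set (eta := / INR (S k)).
  assert (Heta : 0 < eta <= 1).
  { unfold eta. assert (L : 1 <= INR (S k)) by (rewrite S_INR; generalize (pos_INR k); lra).
    split; [apply Rinv_0_lt_compat; lra|]. rewrite <- Rinv_1. apply Rinv_le_contravar; lra. }
  (* Strictly above [1 - eta], as a labelled step requires. *)
  set (r := 1 - eta / 2). assert (Hr : 0 < r < 1) by (unfold r; lra).
  assert (Hr2 : 0 < r ^ 2 < 1) by nra.
  (* The midpoint of [r ^ 2] and 1 leaves room between the disc of the step and the given hyperbolic
     disc. *)
  destruct (tanh_radius ((1 + r ^ 2) / 2)) as [R0 [HR0 ET]]; [lra|].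
  destruct (Hbig R0 HR0) as [a [Da Ha]].
  destruct (large_disc_step Om a R0 r Da Hr) as (p' & q & x & Hst & Hx & Hrat); auto.
  { rewrite ET. lra. }
  exists (q, (x, eta)). simpl. split; [|split; auto].
  - eapply disc_step_l, disc_step_sym, Hst.
  - apply (Relation_Operators.tn1_trans _ _ _ (p', (1, 2))).
    + repeat split; simpl; auto; try lra. rewrite Hrat. unfold r. lra.
    + apply labelled_path; auto. apply disc_step_connected; auto. eapply disc_step_l, Hst.
Qed.

Theorem large_discs_not_contractive (Om : C -> Prop) : subdomain_of_disc Om ->
  (forall R0, 0 < R0 -> exists a, in_disc a /\ forall w, hyp_disc a R0 w -> Om w) ->
  ~ contractive Om.
Proof.
  intros HOm Hbig Hcon.
  destruct (large_discs_chain Om HOm Hbig) as (st & Hst & Heta).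
  destruct HOm as (_ & _ & _ & HD).
  set (p := fun n => fst (st n)). set (x := fun n => fst (snd (st (S n)))).
  set (eta := fun n => snd (snd (st (S n)))).
  assert (Hstep : forall n, disc_step Om (p n) (p (S n))) by (intros n; apply (Hst n)).
  assert (Hx : forall n, 0 < x n) by (intros n; apply (Hst n)).
  destruct (functional_choice (fun n d => 0 < d /\ forall v,
      Cmod (v - (p n + p (S n)) / 2) <= Cmod (p (S n) - p n) / 2 + d -> Om v)) as [dl Hdl];
    [exact Hstep|].
  set (v0 := fun n => (p n + (p (S n) - p n) * RtoC (x n / (1 + x n)))%C).
  set (m0 := fun n => 2 * x n / (1 + x n) ^ 2 * Cmod (p (S n) - p n)).
  assert (Dv0 : forall n, 0 < 1 - Cmod (v0 n) ^ 2).
  { intros n. apply in_disc_sqr, (disc_step_inside Om); auto. apply Rlt_le, Hx. }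
  (* The strict inequality for [step_ratio], cleared of its denominator. *)
  set (gap := fun n => m0 n - (1 - eta n) * (1 - Cmod (v0 n) ^ 2)).
  assert (Hgap : forall n, 0 < gap n).
  { intros n. destruct (Hst n) as (_ & _ & _ & L). unfold step_ratio in L.
    fold (p n) (p (S n)) (x n) (eta n) in L. fold (m0 n) (v0 n) in L.
    apply Rlt_div_r in L; [|apply Dv0]. unfold gap. lra. }
  (* The first bound keeps the values in [Om]; the second contradicts the inequality
     [gap n <= 2 * tau n] that contractivity will imply. *)
  set (tau := fun n => Rmin (dl n) (gap n / 8)).
  assert (Htau : forall n, 0 < tau n).
  { intros n. apply Rmin_pos; [apply (Hdl n)|generalize (Hgap n); lra]. }
  assert (Htau1 : forall n, tau n <= dl n) by (intros; apply Rmin_l).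
  assert (Htau2 : forall n, tau n <= gap n / 8) by (intros; apply Rmin_r).
  destruct (exists_scales tau x Htau Hx) as (t & s & Hs & Ht & Hlo & Hhi & Hxt).
  assert (Htp : forall n, 0 < t n).
  { intros n. eapply Rlt_le_trans; [|apply Ht]. apply pow_lt. lra. }
  assert (Dp : forall n, in_disc (p n)) by (intros n; eapply HD, disc_step_l, Hstep).
  assert (Hd2 : forall n, Cmod (p (S n) - p n) <= 2).
  { intros n. unfold Cminus. eapply Rle_trans; [apply Cmod_triangle|]. rewrite Cmod_opp.
    generalize (Dp n) (Dp (S n)). unfold in_disc. lra. }
  destruct (ramp_series_exist (fun k => p (S k) - p k)%C t Hd2 Ht) as (F & G & HFG).
  set (f := fun z => (p O + F (cayley z))%C).
  assert (Hf' : forall z, in_disc z ->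
            cderiv f z (0 + 2 / ((1 - z) * (1 - z)) * G (cayley z))%C).
  { intros z Dz. apply (cderiv_plus (fun _ => p O) (fun z => F (cayley z))); [apply cderiv_const|].
    apply (cderiv_comp F cayley); [|apply cderiv_cayley, Dz].
    apply (ramp_series_cderiv _ t F G Hd2 Ht HFG). apply Re_cayley, Dz. }
  assert (HfO : forall z, in_disc z -> Om (f z)).
  { intros z Dz. set (u := cayley z). assert (Hu : 0 < Re u) by apply Re_cayley, Dz.
    destruct (window_cover s u Hs) as [n Wn].
    destruct (ramp_series_window p t s tau F G n u Hd2 Ht (Htau n) Hlo Hhi HFG Hu Wn) as [B _].
    apply (Hdl n). unfold f. fold u.
    eapply Rle_trans; [apply (Cmod_minus_triangle _ (p n + (p (S n) - p n) * (u / (u + RtoC (t n))))%C)|].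
    assert (B2 : Cmod (p n + (p (S n) - p n) * (u / (u + RtoC (t n))) - (p n + p (S n)) / 2)
                 <= Cmod (p (S n) - p n) / 2).
    { replace (p n + (p (S n) - p n) * (u / (u + RtoC (t n))) - (p n + p (S n)) / 2)%C
        with ((p (S n) - p n) * (u / (u + RtoC (t n)) - / 2))%C.
      2:{ field. apply (half_plane_lower u (t n)); auto. }
      rewrite Cmod_mult. destruct (ramp_bounds u (t n) Hu (Htp n)) as (_ & _ & B3 & _).
      apply Rmult_le_compat_l; [apply Cmod_ge_0|exact B3]. }
    generalize (Htau1 n) (Htau n). lra. }
  destruct (Hcon f) as [c [Hc Hcb]]; auto.
  { intros z Dz. eexists. apply has_cderiv_cderiv, Hf', Dz. }
  assert (Hk : exists k, / INR (S k) < 1 - c).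
  { destruct (archimed_cor1 (1 - c)) as [N [HN PN]]; [lra|].
    exists (Nat.pred N). rewrite Nat.succ_pred by lia. exact HN. }
  destruct Hk as [k Hk]. destruct (Heta k) as [n Hn]. fold (eta n) in Hn.
  assert (Heta1 : 0 < eta n <= 1).
  { rewrite Hn. assert (L : 1 <= INR (S k)) by (rewrite S_INR; generalize (pos_INR k); lra).
    split; [apply Rinv_0_lt_compat; lra|]. rewrite <- Rinv_1. apply Rinv_le_contravar; lra. }
  rewrite <- Hn in Hk.
  (* The [n]-th conformal map takes the value [v0 n] at [u0]; [y] is the preimage of [u0] under
     [cayley]. *)
  set (u0 := x n * t n). assert (Hu0 : 0 < u0) by (apply Rmult_lt_0_compat; auto).
  set (y := (u0 - 1) / (u0 + 1)).
  assert (Dz0 : in_disc (RtoC y)).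
  { unfold in_disc. rewrite Cmod_R. apply Rabs_def1.
    - unfold y. apply Rlt_div_l; lra.
    - unfold y. apply Rlt_div_r; lra. }
  assert (Ny : RtoC (1 - y) <> 0).
  { apply RtoC_neq_0. unfold y. replace (1 - (u0 - 1) / (u0 + 1)) with (2 / (u0 + 1)) by (field; lra).
    apply Rgt_not_eq, Rdiv_lt_0_compat; lra. }
  assert (Ecay : cayley (RtoC y) = RtoC u0).
  { unfold cayley. rewrite <- RtoC_plus, <- RtoC_minus, <- RtoC_div.
    - f_equal. unfold y. field. lra.
    - intros E. apply Ny. now rewrite E. }
  assert (Hder := Hf' _ Dz0). rewrite Ecay in Hder.
  specialize (Hcb _ _ Dz0 (proj2 (has_cderiv_cderiv _ _ _) Hder)).
  assert (Eder : Cmod (0 + 2 / ((1 - RtoC y) * (1 - RtoC y)) * G (RtoC u0))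
                 = (u0 + 1) ^ 2 / 2 * Cmod (G (RtoC u0))).
  { rewrite Cplus_0_l, Cmod_mult. f_equal.
    rewrite <- RtoC_minus, <- RtoC_mult, <- RtoC_div.
    2:{ intros E. assert (N2 := Cmult_neq_0 _ _ Ny Ny). apply N2. rewrite <- RtoC_mult. now rewrite E. }
    replace (2 / ((1 - y) * (1 - y))) with ((u0 + 1) ^ 2 / 2) by (unfold y; field; lra).
    rewrite Cmod_R, Rabs_right; [reflexivity|].
    apply Rle_ge, Rmult_le_pos; [apply pow2_ge_0|lra]. }
  rewrite Eder in Hcb.
  assert (Ey : Cmod (RtoC y) ^ 2 = y ^ 2) by (rewrite Cmod_R; apply pow2_abs).
  rewrite Ey in Hcb.
  (* The factor [2 * u0] is twice the real part, as the hyperbolic metric of the half-plane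
     predicts. *)
  replace ((1 - y ^ 2) * ((u0 + 1) ^ 2 / 2 * Cmod (G (RtoC u0))))
    with (2 * u0 * Cmod (G (RtoC u0))) in Hcb by (unfold y; field; lra).
  assert (Df := in_disc_sqr _ (HD _ (HfO _ Dz0))).
  apply Rle_div_l in Hcb; [|exact Df].
  assert (Wn : in_window s n (RtoC u0)).
  { unfold in_window. rewrite Cmod_R, Rabs_right by lra. destruct (Hxt n) as [X1 X2]. split; auto. }
  destruct (ramp_series_window p t s tau F G n (RtoC u0) Hd2 Ht (Htau n) Hlo Hhi HFG Hu0 Wn) as [B1 B2].
  assert (Ex : (RtoC u0 / (RtoC u0 + RtoC (t n)))%C = RtoC (x n / (1 + x n))).
  { generalize (Htp n) (Hx n). intros T1 T2.
    rewrite <- RtoC_plus, <- RtoC_div by lra. f_equal. unfold u0. field. split; nra. }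
  rewrite Ex in B1. fold (v0 n) in B1.
  replace (p O + F (RtoC u0))%C with (f (RtoC y)) in B1 by (unfold f; now rewrite Ecay).
  set (g := ((p (S n) - p n) * (RtoC (t n) / ((RtoC u0 + RtoC (t n)) * (RtoC u0 + RtoC (t n)))))%C) in *.
  assert (Eg : 2 * u0 * Cmod g = m0 n).
  { unfold g, m0. generalize (Htp n) (Hx n). intros T1 T2.
    rewrite <- RtoC_plus, <- RtoC_mult, <- RtoC_div by nra.
    rewrite Cmod_mult, Cmod_R, Rabs_right.
    - unfold u0. field. split; nra.
    - apply Rle_ge, Rlt_le, Rdiv_lt_0_compat; nra. }
  assert (LG : m0 n - tau n <= 2 * u0 * Cmod (G (RtoC u0))).
  { rewrite <- Eg. rewrite Cmod_mult, Cmod_R, Rabs_right in B2 by lra.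
    generalize (Cmod_triangle_rev g (G (RtoC u0))). rewrite Cmod_minus_sym. nra. }
  (* The moduli differ by at most [tau n / 2] and their sum is at most 2. *)
  assert (Lf : 1 - Cmod (f (RtoC y)) ^ 2 <= 1 - Cmod (v0 n) ^ 2 + tau n).
  { assert (Q1 := Cmod_triangle_rev (v0 n) (f (RtoC y))). rewrite Cmod_minus_sym in Q1.
    assert (Q2 := Cmod_ge_0 (v0 n)). assert (Q3 := Cmod_ge_0 (f (RtoC y))).
    generalize (Dv0 n) (HD _ (HfO _ Dz0)) (Htau n). unfold in_disc. intros Q4 Q5 Q6.
    assert (Q7 : Cmod (v0 n) < 1) by nra.
    assert ((Cmod (v0 n) - Cmod (f (RtoC y))) * (Cmod (v0 n) + Cmod (f (RtoC y))) <= tau n); [|nra].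
    destruct (Rle_lt_dec (Cmod (v0 n)) (Cmod (f (RtoC y)))) as [L|L]; nra. }
  generalize (Htau2 n) (Htau n). unfold gap. intros T2 T3.
  assert (L1 : c * (1 - Cmod (f (RtoC y)) ^ 2) <= (1 - eta n) * (1 - Cmod (f (RtoC y)) ^ 2))
    by (apply Rmult_le_compat_r; lra).
  assert (L2 : (1 - eta n) * (1 - Cmod (f (RtoC y)) ^ 2) <= (1 - eta n) * (1 - Cmod (v0 n) ^ 2 + tau n))
    by (apply Rmult_le_compat_l; lra).
  assert (L3 : (1 - eta n) * tau n <= tau n) by nra.
  lra.
Qed.

Theorem mainTheorem13 (Om : C -> Prop) :
  subdomain_of_disc Om ->
  (contractive Om <->
   exists R : R, 0 < R /\
     ~ (exists a : C, in_disc a /\ forall w, hyp_disc a R w -> Om w)).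
Proof.
  intros HOm. split.
  - intros Hcon. apply NNPP. intros Hno.
    apply (large_discs_not_contractive Om HOm); auto.
    intros R0 HR0. apply NNPP. intros Hn. apply Hno. exists R0. auto.
  - intros (R0 & HR0 & Hn). apply (no_large_disc_contractive Om R0); auto. apply HOm.
Qed.
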